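(* There exists an absolute constant $C>0$ such that for every integer $d\ge2$ and every $\varepsilon\in(0,\pi/2)$ there exists a geodesic $\varepsilon$-net of $\mathbb S^d$ with cardinality bounded by $$d\,\max\Big\{2,\ \frac{C\,\ln\ln(2/V(\varepsilon))}{V(\varepsilon)}\Big\}.$$
   Context: $\mathbb S^d\subset\mathbb R^{d+1}$ is the Euclidean unit sphere, $\sigma$ the normalized (total mass $1$) Lebesgue surface measure on $\mathbb S^d$, and $\varrho(x,y)=\arccos\langle x,y\rangle$ the geodesic distance. $V(\varphi)=\sigma(\{y\in\mathbb S^d:\varrho(x,y)\le\varphi\})$ is the normalized volume of a cap of geodesic radius $\varphi\in[0,\pi]$ (independent of the center $x\in\mathbb S^d$). A set $\mathcal N\subset\mathbb S^d$ is a geodesic $\varepsilon$-net of $\mathbb S^d$ if for every $x\in\mathbb S^d$ there is $y\in\mathcal N$ with $\varrho(x,y)\le\varepsilon$. *)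

(* Defs.v *)
From HB Require Import structures.
From mathcomp Require Import all_boot all_order all_algebra finmap.
From mathcomp Require Import all_classical all_reals all_analysis.

Set Implicit Arguments.
Unset Strict Implicit.
Unset Printing Implicit Defensive.
Import Order.TTheory GRing.Theory Num.Theory.
Import numFieldNormedType.Exports.

Local Open Scope classical_set_scope.
Local Open Scope ring_scope.

Section lebesgue_tuple.
Context {R : realType}.
Local Notation T := (measurableTypeR R).

Definition cons_pair n (p : T * n.-tuple T) : n.+1.-tuple T :=
  [tuple of p.1 :: p.2].

Lemma measurable_cons_pair n : measurable_fun [set: T * n.-tuple T] (@cons_pair n).
Proof. exact: (measurable_cons measurable_fst measurable_snd). Qed.

Section step.
Variables (n : nat) (mu : {sigma_finite_measure set (n.-tuple T) -> \bar R}).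

Definition lebesgue_step : set (n.+1.-tuple T) -> \bar R :=
  pushforward (@lebesgue_measure R \x mu)%E (@cons_pair n).

Let lebesgue_step0 : lebesgue_step set0 = 0%E.
Proof. by rewrite /lebesgue_step /pushforward preimage_set0 measure0. Qed.

Let lebesgue_step_ge0 A : (0 <= lebesgue_step A)%E.
Proof. by rewrite /lebesgue_step /pushforward measure_ge0. Qed.

Let lebesgue_step_sigma_additive : semi_sigma_additive lebesgue_step.
Proof.
move=> F mF tF mUF; rewrite /lebesgue_step /pushforward preimage_bigcup.
have mcp := @measurable_cons_pair n.
apply: measure_semi_sigma_additive.
- by move=> i; rewrite -[X in measurable X]setTI; exact: mcp.
- apply/trivIsetP => /= i j _ _ ij; rewrite -preimage_setI.
  by move/trivIsetP : tF => /(_ _ _ _ _ ij) ->//; rewrite preimage_set0.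
- by rewrite -preimage_bigcup -[X in measurable X]setTI; exact: mcp.
Qed.

HB.instance Definition _ := isMeasure.Build _ _ _ lebesgue_step
  lebesgue_step0 lebesgue_step_ge0 lebesgue_step_sigma_additive.

Let lebesgue_step_sigma_finite : sigma_finite setT lebesgue_step.
Proof.
have /sigma_finiteP[F [FT ndF Foo]] := sigma_finiteT (@lebesgue_measure R).
have /sigma_finiteP[G [GT ndG Goo]] := sigma_finiteT mu.
pose f (t : n.+1.-tuple T) : T * n.-tuple T := (thead t, [tuple of behead t]).
have mf : measurable_fun setT f.
  apply/measurable_fun_pair; last exact: measurable_behead.
  exact: measurable_tnth.
exists (fun k => f @^-1` (F k `*` G k)).
  rewrite -preimage_bigcup (_ : \bigcup_k _ = setT) ?preimage_setT//.
  apply/seteqP; split => // -[x y] _.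
  have [i _ Fix] : (\bigcup_i F i) x by rewrite -FT.
  have [j _ Gjy] : (\bigcup_j G j) y by rewrite -GT.
  exists (maxn i j) => //; split => /=.
    by move: x Fix; exact/subsetPset/ndF/leq_maxl.
  by move: y Gjy; exact/subsetPset/ndG/leq_maxr.
move=> k; have [mF Fk] := Foo k; have [mG Gk] := Goo k; split.
  by rewrite -[X in measurable X]setTI; apply: mf => //; exact: measurableX.
rewrite /lebesgue_step /pushforward -comp_preimage (_ : f \o _ = id).
  by rewrite preimage_id product_measure1E// lte_mul_pinfty// ge0_fin_numE.
apply/funext => -[x t] /=; rewrite /f /cons_pair /= theadE.
by congr pair; exact/val_inj.
Qed.

HB.instance Definition _ := Measure_isSigmaFinite.Build _ _ _ lebesgue_step
  lebesgue_step_sigma_finite.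

End step.

(* Lebesgue measure on R^n, as the n-fold product of the Lebesgue measure
   on R (with the point mass on R^0). *)
Fixpoint lebesgue_tuple n : {sigma_finite_measure set (n.-tuple T) -> \bar R} :=
  if n is m.+1 then lebesgue_step (lebesgue_tuple m) else \d_([tuple] : 0.-tuple T).

End lebesgue_tuple.

Section sphere.
Context {R : realType}.

Definition volume n (A : set 'rV[R]_n) : \bar R :=
  lebesgue_tuple n [set t | A (\row_i tnth t i)].

(* The norm that the library puts on row vectors is the sup norm, so the
   Euclidean structure is expressed with the inner product. *)
Definition dotp n (x y : 'rV[R]_n) : R := \sum_i x 0 i * y 0 i.

Definition unit_ball n : set 'rV[R]_n := [set x | dotp x x <= 1].

Definition sphere d : set 'rV[R]_d.+1 := [set x | dotp x x = 1].

Definition geodist d (x y : 'rV[R]_d.+1) : R := acos (dotp x y).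

Definition cone d (A : set 'rV[R]_d.+1) : set 'rV[R]_d.+1 :=
  [set z | exists r x, [/\ 0 <= r <= 1, A x & z = r *: x]].

(* Normalized surface measure of A `<=` sphere d. The surface measure is
   A |-> (d + 1) * volume (cone A) (polar coordinates); the factor d + 1
   disappears in the normalization by the total mass since the cone over the
   sphere is the unit ball. *)
Definition sigma d (A : set 'rV[R]_d.+1) : R :=
  fine (volume (cone A)) / fine (volume (@unit_ball d.+1)).

Definition cap d (x : 'rV[R]_d.+1) (phi : R) : set 'rV[R]_d.+1 :=
  [set y | sphere y /\ geodist x y <= phi].

(* sigma (cap x phi) does not depend on the center x in the sphere, by
   invariance under rotations; the center is fixed to the first basis vector. *)
Definition pole d : 'rV[R]_d.+1 := delta_mx 0 0.

Definition capV d (phi : R) : R := sigma (cap (pole d) phi).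

Definition geodesic_net d (eps : R) (N : set 'rV[R]_d.+1) : Prop :=
  N `<=` @sphere d /\
  forall x, sphere x -> exists2 y, N y & geodist x y <= eps.

End sphere.

(* Main.v *)
(* Let t = cos eps, S = sin eps, V the normalized volume of a cap of radius eps and
   L = ln (2 / V). Take a net of centers x with mesh th ~ S / (sqrt d t'), and
   shrink the cap around each x to A_x = {z : <x, z> >= t'}, where
   t'^2 = t^2 + S^2 / (16 d); its volume is still at least a constant times V.
   If y is within th of x, then a point z of A_x can lie outside of the cap around y
   only if its component along the direction of y - x is unusually large.

   On A_x the components <u, z> orthogonal to x are subgaussian, so that
   exp (c d <u, z>^2 / S^2) has bounded mean. Hence for N random points, except with
   probability exp (- c N V), some of them lie in A_x and the quadratic form
   u |-> sum of <u, z>^2 over these is small on average; to bound it for all unit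
   vectors u it is enough to do so on a 1/2-net. Then for every y near x at once some
   z covers y. This replaces the VC-dimension argument for epsilon-nets.

   The few centers for which this fails are added to the net. If M is the number
   of pairs (x, u), there are at most M exp (- c N V) of them, which is at most 1 / V
   for N ~ ln (M V) / V; and (M V)^2 <= (C L)^d, by volume packing and elementary
   bounds on V. The random points are chosen by conditional expectations. *)
Require Import Defs.
From mathcomp Require Import all_boot all_order all_algebra finmap.
From mathcomp Require Import all_classical all_reals all_analysis.
From mathcomp Require Import measurable_realfun.
From mathcomp Require Import ring lra.
Set Implicit Arguments.
Unset Strict Implicit.
Unset Printing Implicit Defensive.
Import Order.TTheory GRing.Theory Num.Theory.
Import numFieldNormedType.Exports.
Local Open Scope classical_set_scope.
Local Open Scope ring_scope.

(** * Row vectors and Lebesgue measure *)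

Section row_vectors.
Context {R : realType}.

(** The obstacle is to keep ln (M V) of order d ln L. Shrinking a cap at the cost of a constant
    factor of V gains only t' - t, about S^2 / (32 d t'), whereas moving its center by th can change
    <y, z> by th S in the worst case. A worst-case argument thus needs th of order S / (d t'), and
    the extra factor sqrt d in 1 / th puts (d / 2) ln d into ln M, too much for large caps. For most
    z, however, the component <u, z> is only of order S / sqrt d; asking for one typical sample
    point that may depend on y, and not for all of them, allows the larger mesh.

    The factor t' in the mesh brings in L in place of d: 1 / th^2 is a multiple of (d t^2 + S^2 /
    16) / S^2, where d t^2 is O(L) because a cap at height t has volume at most exp (- c d t^2), and
    the powers of S are absorbed by V.

    Everything is computed with volumes in the unit ball: caps become cones, the points are drawn
    from the ball and projected to the sphere at the end, and slices of a cone orthogonal to its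
    axis are balls, so that Fubini makes the estimates elementary. *)

Definition vcons n (x : R) (w : 'rV[R]_n) : 'rV[R]_n.+1 :=
  \row_i (if unlift ord0 i is Some j then w 0 j else x).

Definition vtail n (z : 'rV[R]_n.+1) : 'rV[R]_n := \row_i z 0 (lift ord0 i).

Lemma vcons_head n x (w : 'rV[R]_n) : vcons x w 0 0 = x.
Proof. by rewrite mxE unlift_none. Qed.

Lemma vcons_lift n x (w : 'rV[R]_n) j : vcons x w 0 (lift ord0 j) = w 0 j.
Proof. by rewrite mxE liftK. Qed.

Lemma vtail_cons n x (w : 'rV[R]_n) : vtail (vcons x w) = w.
Proof. by apply/rowP => j; rewrite mxE vcons_lift. Qed.

Lemma vcons_eta n (z : 'rV[R]_n.+1) : vcons (z 0 0) (vtail z) = z.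
Proof.
by apply/rowP => i; rewrite mxE; case: unliftP => [j ->|->//]; rewrite mxE.
Qed.

Lemma vconsD n x y (w u : 'rV[R]_n) :
  vcons x w + vcons y u = vcons (x + y) (w + u).
Proof.
by apply/rowP => i; rewrite !mxE; case: unliftP => [j _|_]; rewrite ?mxE.
Qed.

Lemma vconsZ n a x (w : 'rV[R]_n) : a *: vcons x w = vcons (a * x) (a *: w).
Proof.
by apply/rowP => i; rewrite !mxE; case: unliftP => [j _|_]; rewrite ?mxE.
Qed.

Lemma dotpC n (x y : 'rV[R]_n) : dotp x y = dotp y x.
Proof. by apply: eq_bigr => i _; rewrite mulrC. Qed.

Lemma dotpDl n (x y z : 'rV[R]_n) : dotp (x + y) z = dotp x z + dotp y z.
Proof. by rewrite -big_split; apply: eq_bigr => i _; rewrite mxE mulrDl. Qed.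

Lemma dotpZl n a (x z : 'rV[R]_n) : dotp (a *: x) z = a * dotp x z.
Proof. by rewrite mulr_sumr; apply: eq_bigr => i _; rewrite mxE mulrA. Qed.

Lemma dotpDr n (x y z : 'rV[R]_n) : dotp z (x + y) = dotp z x + dotp z y.
Proof. by rewrite dotpC dotpDl !(dotpC z). Qed.

Lemma dotpZr n a (x z : 'rV[R]_n) : dotp z (a *: x) = a * dotp z x.
Proof. by rewrite dotpC dotpZl (dotpC z). Qed.

Lemma dotpNl n (x z : 'rV[R]_n) : dotp (- x) z = - dotp x z.
Proof. by rewrite -scaleN1r dotpZl mulN1r. Qed.

Lemma dotpNr n (x z : 'rV[R]_n) : dotp z (- x) = - dotp z x.
Proof. by rewrite dotpC dotpNl (dotpC z). Qed.

Lemma dotp0l n (x : 'rV[R]_n) : dotp 0 x = 0.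
Proof. by rewrite -(scale0r x) dotpZl mul0r. Qed.

Definition dotpE := (dotpDl, dotpDr, dotpNl, dotpNr, dotpZl, dotpZr).

Lemma dotp_ge0 n (x : 'rV[R]_n) : 0 <= dotp x x.
Proof. by apply: sumr_ge0 => i _; rewrite -expr2 sqr_ge0. Qed.

Lemma dotp_eq0 n (x : 'rV[R]_n) : (dotp x x == 0) = (x == 0).
Proof.
apply/eqP/eqP => [|->]; last by rewrite dotp0l.
move/eqP; rewrite psumr_eq0; last by move=> i _; rewrite -expr2 sqr_ge0.
move=> /allP x0; apply/rowP => i; rewrite mxE; apply/eqP.
by have := x0 i (mem_index_enum _); rewrite mulf_eq0 orbb.
Qed.

Lemma dotp_cons n x y (w u : 'rV[R]_n) :
  dotp (vcons x w) (vcons y u) = x * y + dotp w u.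
Proof.
rewrite /dotp big_ord_recl !vcons_head; congr (_ + _).
by apply: eq_bigr => i _; rewrite !vcons_lift.
Qed.

Lemma dotp_CS n (x y : 'rV[R]_n) : dotp x y ^+ 2 <= dotp x x * dotp y y.
Proof.
have [/eqP|y0] := boolP (dotp y y == 0).
  by move/eqP; rewrite dotp_eq0 => /eqP ->; rewrite (dotpC x) !dotp0l expr0n mulr0.
have yp : 0 < dotp y y by rewrite lt_neqAle eq_sym y0 dotp_ge0.
have := dotp_ge0 (dotp y y *: x - dotp x y *: y).
rewrite !dotpE !(dotpC y x) => h.
rewrite -subr_ge0 -(pmulr_rge0 _ yp); apply: le_trans h _.
by rewrite le_eqVlt; apply/orP; left; apply/eqP; ring.
Qed.

Lemma poleE n : pole n = vcons 1 0 :> 'rV[R]_n.+1.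
Proof.
apply/rowP => i; rewrite !mxE; case: unliftP => [j ->|->]; rewrite ?mxE ?eqxx//=.
Qed.

Lemma dotp_pole n (z : 'rV[R]_n.+1) : dotp (pole n) z = z 0 0.
Proof. by rewrite -[z]vcons_eta poleE dotp_cons dotp0l mul1r addr0 vcons_head. Qed.

End row_vectors.

(** * Measurable sets and functions of row vectors *)

Section measurability.
Context {R : realType}.
Local Notation T := (measurableTypeR R).

Definition vec n (t : n.-tuple T) : 'rV[R]_n := \row_i tnth t i.

Definition tup n (z : 'rV[R]_n) : n.-tuple T := [tuple z 0 i | i < n].

Lemma tupK n : cancel (@tup n) (@vec n).
Proof. by move=> z; apply/rowP => i; rewrite mxE tnth_mktuple. Qed.

Lemma vec_cons n (x : T) (t : n.-tuple T) :
  vec (cons_pair (x, t)) = vcons x (vec t).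
Proof.
apply/rowP => i; rewrite !mxE; case: unliftP => [j ->|->].
  by rewrite mxE /cons_pair tnthS.
by rewrite /cons_pair tnth0.
Qed.

(* The sigma-algebra is the one of tuples, on which [volume] is defined. *)
Definition mset n (A : set 'rV[R]_n) : Prop := measurable (@vec n @^-1` A).

Definition mfunc n (f : 'rV[R]_n -> R) : Prop :=
  measurable_fun [set: n.-tuple T] (f \o @vec n : _ -> T).

Lemma eq_mfunc n (f g : 'rV[R]_n -> R) : f =1 g -> mfunc g -> mfunc f.
Proof. by move=> /funext ->. Qed.

Lemma mfunc_cst n (c : R) : mfunc (fun _ : 'rV[R]_n => c).
Proof. exact: measurable_cst. Qed.

Lemma mfunc_coord n (i : 'I_n) : mfunc (fun z : 'rV[R]_n => z 0 i).
Proof.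
rewrite /mfunc (_ : _ \o _ = (@tnth n T)^~ i); first exact: measurable_tnth.
by apply/funext => t /=; rewrite mxE.
Qed.

Lemma mfuncD n (f g : 'rV[R]_n -> R) :
  mfunc f -> mfunc g -> mfunc (fun z => f z + g z).
Proof. exact: measurable_funD. Qed.

Lemma mfuncB n (f g : 'rV[R]_n -> R) :
  mfunc f -> mfunc g -> mfunc (fun z => f z - g z).
Proof. exact: measurable_funB. Qed.

Lemma mfuncM n (f g : 'rV[R]_n -> R) :
  mfunc f -> mfunc g -> mfunc (fun z => f z * g z).
Proof. exact: measurable_funM. Qed.

Lemma mfuncX n (f : 'rV[R]_n -> R) k : mfunc f -> mfunc (fun z => f z ^+ k).
Proof. exact: measurable_funX. Qed.

Lemma mfunc_sum n m (f : 'I_m -> 'rV[R]_n -> R) :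
  (forall i, mfunc (f i)) -> mfunc (fun z => \sum_i f i z).
Proof.
move=> mf; rewrite /mfunc.
rewrite (_ : _ \o _ = (fun t => \sum_i (f i \o @vec n) t)) //.
by apply: measurable_sum => i; exact: mf.
Qed.

Lemma mfunc_dotp n m (f g : 'rV[R]_n -> 'rV[R]_m) :
  (forall i, mfunc (fun z => f z 0 i)) -> (forall i, mfunc (fun z => g z 0 i)) ->
  mfunc (fun z => dotp (f z) (g z)).
Proof. by move=> mf mg; apply: mfunc_sum => i; exact: mfuncM. Qed.

Lemma mset_le n (f g : 'rV[R]_n -> R) :
  mfunc f -> mfunc g -> mset [set z | f z <= g z].
Proof.
move=> mf mg; have := measurable_fun_ler mf mg => /(_ measurableT [set true]).
by rewrite setTI; apply.
Qed.

Lemma mset_lt n (f g : 'rV[R]_n -> R) :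
  mfunc f -> mfunc g -> mset [set z | f z < g z].
Proof.
move=> mf mg; have := measurable_fun_ltr mf mg => /(_ measurableT [set true]).
by rewrite setTI; apply.
Qed.

Lemma msetI n (A B : set 'rV[R]_n) : mset A -> mset B -> mset (A `&` B).
Proof. exact: measurableI. Qed.

Lemma msetU n (A B : set 'rV[R]_n) : mset A -> mset B -> mset (A `|` B).
Proof. exact: measurableU. Qed.

Lemma msetD n (A B : set 'rV[R]_n) : mset A -> mset B -> mset (A `\` B).
Proof. exact: measurableD. Qed.

(** Measurability of a map into tuples is checked coordinatewise, and [tup] transfers this to row
    vectors. *)
Lemma mset_preimage n m (f : 'rV[R]_n -> 'rV[R]_m) (A : set 'rV[R]_m) :
  (forall i, mfunc (fun z => f z 0 i)) -> mset A -> mset (f @^-1` A).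
Proof.
move=> mf mA; have mft : measurable_fun setT (fun t => tup (f (vec t))).
  apply/measurable_fun_tnthP => i; rewrite (_ : _ \o _ = fun t => f (vec t) 0 i).
    exact: mf.
  by apply/funext => t /=; rewrite tnth_mktuple.
have := mft measurableT _ mA; rewrite setTI /mset.
suff -> : (fun t => tup (f (vec t))) @^-1` (@vec m @^-1` A) =
  @vec n @^-1` (f @^-1` A) by [].
by apply/seteqP; split => t /=; rewrite tupK.
Qed.

Lemma measurable_vcons n (A : set 'rV[R]_n.+1) : mset A ->
  measurable [set p : T * n.-tuple T | A (vcons p.1 (vec p.2))].
Proof.
move=> mA; have := @measurable_cons_pair R n measurableT _ mA; rewrite setTI.
by congr measurable; apply/seteqP; split => -[x t]/=; rewrite vec_cons.
Qed.

Lemma mset_slice n (A : set 'rV[R]_n.+1) x :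
  mset A -> mset [set w | A (vcons x w)].
Proof.
move=> mA; apply: mset_preimage mA => i.
case: (unliftP ord0 i) => [j ->|->].
  by apply: eq_mfunc (mfunc_coord j) => z; rewrite vcons_lift.
by apply: eq_mfunc (mfunc_cst x) => z; rewrite vcons_head.
Qed.

Lemma measurable_slice n (A : set 'rV[R]_n.+1) w :
  mset A -> measurable ([set x | A (vcons x w)] : set T).
Proof.
move=> mA; have := measurable_ysection (tup w) (measurable_vcons mA).
congr measurable; apply/seteqP; split => x; rewrite /ysection /=.
  by rewrite inE /= tupK.
by rewrite inE /= tupK.
Qed.

End measurability.

(** * Volume as an iterated integral, in both orders *)

Section volume_theory.
Context {R : realType}.
Local Notation T := (measurableTypeR R).
Local Notation lam := (@lebesgue_measure R).
Local Open Scope ereal_scope.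

Lemma volumeE n (A : set 'rV[R]_n) : volume A = lebesgue_tuple n (@vec R n @^-1` A).
Proof. by []. Qed.

Lemma volume_ge0 n (A : set 'rV[R]_n) : 0 <= volume A.
Proof. exact: measure_ge0. Qed.

Lemma volume0 n : volume (set0 : set 'rV[R]_n) = 0.
Proof. by rewrite volumeE preimage_set0 measure0. Qed.

Lemma le_volume n (A B : set 'rV[R]_n) :
  mset A -> mset B -> A `<=` B -> volume A <= volume B.
Proof.
by move=> mA mB AB; apply: le_measure; rewrite ?inE //; exact: preimage_subset.
Qed.

Lemma volumeU n (A B : set 'rV[R]_n) : mset A -> mset B -> A `&` B = set0 ->
  volume (A `|` B) = volume A + volume B.
Proof.
move=> mA mB AB; rewrite !volumeE preimage_setU measureU//.
by rewrite -preimage_setI AB preimage_set0.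
Qed.

Lemma volumeU_le n (A B : set 'rV[R]_n) : mset A -> mset B ->
  volume (A `|` B) <= volume A + volume B.
Proof. by move=> mA mB; rewrite !volumeE preimage_setU; exact: measureU2. Qed.

Lemma volume_step n (A : set 'rV[R]_n.+1) :
  volume A = (lam \x lebesgue_tuple n)
    [set p : T * n.-tuple T | A (vcons p.1 (vec p.2))].
Proof.
rewrite /volume /= /lebesgue_step /pushforward; congr (product_measure1 _ _ _).
by apply/seteqP; split => -[x t] /=; rewrite -/(vec _) vec_cons.
Qed.

Lemma volume_slice1 n (A : set 'rV[R]_n.+1) :
  volume A = \int[lam]_x volume [set w | A (vcons x w)].
Proof.
rewrite volume_step; apply: eq_integral => x _ /=.
by rewrite volumeE; congr (lebesgue_tuple _ _); rewrite xsectionE.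
Qed.

Lemma measurable_volume_slice n (A : set 'rV[R]_n.+1) : mset A ->
  measurable_fun [set: T] (fun x : T => volume [set w | A (vcons x w)]).
Proof.
move=> /measurable_vcons mA.
have := @measurable_fun_xsection _ _ _ _ R (lebesgue_tuple n) _ mA.
congr measurable_fun; apply/funext => x /=.
by rewrite volumeE; congr (lebesgue_tuple _ _); rewrite xsectionE.
Qed.

Lemma volume_slice2 n (A : set 'rV[R]_n.+1) : mset A ->
  volume A = \int[lebesgue_tuple n]_t lam [set x | A (vcons x (vec t))].
Proof.
move=> /measurable_vcons mA; rewrite volume_step.
rewrite (@product_measure_unique _ _ _ _ R lam (lebesgue_tuple n)
  (lam \x^ lebesgue_tuple n)) //; last by move=> *; exact: product_measure2E.
by apply: eq_integral => t _ /=; rewrite ysectionE.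
Qed.

Lemma measurable_lebesgue_slice n (A : set 'rV[R]_n.+1) : mset A ->
  measurable_fun [set: n.-tuple T] (fun t => lam [set x | A (vcons x (vec t))]).
Proof.
move=> /measurable_vcons mA.
have := @measurable_fun_ysection _ _ _ _ R lam _ mA.
by congr measurable_fun; apply/funext => x /=; rewrite ysectionE.
Qed.

(** Through this form of Cavalieri's principle, comparisons of cones become comparisons of balls in
    the hyperplanes orthogonal to the pole. *)
Lemma le_volume_slice1 n (A B : set 'rV[R]_n.+1) (c : R) :
  mset A -> mset B -> (0 <= c)%R ->
  (forall x, volume [set w | A (vcons x w)] <=
             c%:E * volume [set w | B (vcons x w)]) ->
  volume A <= c%:E * volume B.
Proof.
move=> mA mB c0 AB; rewrite !volume_slice1.
rewrite -ge0_integralZl//; last exact: measurable_volume_slice.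
apply: ge0_le_integral => //.
- exact: measurable_volume_slice.
- by apply: measurable_funeM; exact: measurable_volume_slice.
Qed.

End volume_theory.

(** * Volume under affine maps, reflection and shears *)

Section volume_maps.
Context {R : realType}.
Local Notation T := (measurableTypeR R).
Local Notation lam := (@lebesgue_measure R).
Local Open Scope ereal_scope.

Lemma measurable_affine (a b : R) :
  measurable_fun [set: T] (fun x : T => (a * x + b)%R : T).
Proof. by apply: measurable_funD => //; exact: measurable_funM. Qed.

(** The pushforward of [lam] under x |-> a x + b, multiplied by a, agrees with [lam] on the
    intervals ]c, d], hence on all measurable sets. *)
Lemma lebesgue_affine (a b : R) (A : set T) : (0 < a)%R -> measurable A ->
  lam [set x | A (a * x + b)%R] = (a^-1)%:E * lam A.
Proof.
move=> a0 mA; pose f (x : T) : T := (a * x + b)%R.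
have a1 : (0 <= a)%R by exact: ltW.
have mf : measurable_fun setT f by exact: measurable_affine.
pose m0 : {measure set T -> \bar R} := pushforward lam f.
pose m : {measure set T -> \bar R} := mscale (NngNum a1) (m0 mf).
have mE B : m B = a%:E * lam (f @^-1` B) by [].
have := @lebesgue_measure_unique R m _ A mA => -> //.
  by rewrite mE muleA -EFinM mulVf ?gt_eqF// mul1e.
move=> _ [[c d]] _ <-; rewrite mE.
have -> : f @^-1` `]c, d]%classic = `]((c - b) / a)%R, ((d - b) / a)%R]%classic.
  apply/seteqP; split => x /=; rewrite !in_itv/= /f => /andP[].
    by move=> ? ?; rewrite ltr_pdivrMr// ler_pdivlMr//; apply/andP; split; lra.
  by rewrite ltr_pdivrMr// ler_pdivlMr// => ? ?; apply/andP; split; lra.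
rewrite !lebesgue_measure_itv/= !lte_fin ltr_pM2r ?invr_gt0// ltrD2r.
case: ifPn => _; last by rewrite mule0.
by rewrite -!EFinB -EFinM; congr (_%:E); field; rewrite gt_eqF.
Qed.

Lemma eq_volume_slice1 n (A B : set 'rV[R]_n.+1) (c : R) : mset B ->
  (0 <= c)%R ->
  (forall x, volume [set w | A (vcons x w)] =
             c%:E * volume [set w | B (vcons x w)]) ->
  volume A = c%:E * volume B.
Proof.
move=> mB c0 AB; rewrite !volume_slice1 -ge0_integralZl//; last first.
  exact: measurable_volume_slice.
exact: eq_integral.
Qed.

Lemma eq_volume_slice2 n (A B : set 'rV[R]_n.+1) (c : R) : mset A -> mset B ->
  (0 <= c)%R ->
  (forall w, lam [set x | A (vcons x w)] = c%:E * lam [set x | B (vcons x w)]) ->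
  volume A = c%:E * volume B.
Proof.
move=> mA mB c0 AB; rewrite !volume_slice2// -ge0_integralZl//; last first.
  exact: measurable_lebesgue_slice.
exact: eq_integral.
Qed.

Lemma mfunc_vcons n m (f : 'rV[R]_n -> R) (g : 'rV[R]_n -> 'rV[R]_m) :
  mfunc f -> (forall j, mfunc (fun z => g z 0%R j)) ->
  forall i, mfunc (fun z => vcons (f z) (g z) 0%R i).
Proof.
move=> mf mg i; case: (unliftP ord0 i) => [j ->|->].
  by apply: eq_mfunc (mg j) => z; rewrite vcons_lift.
by apply: eq_mfunc mf => z; rewrite vcons_head.
Qed.

Lemma mfunc_affine n (a : R) (b : 'rV[R]_n) i :
  mfunc (fun z : 'rV[R]_n => (a *: z + b)%R 0%R i).
Proof.
apply: (@eq_mfunc _ _ _ (fun z => (a * z 0%R i + b 0%R i)%R)).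
  by move=> z; rewrite !mxE.
apply: mfuncD; last exact: mfunc_cst.
by apply: mfuncM; [exact: mfunc_cst|exact: mfunc_coord].
Qed.

Lemma mset_affine n (A : set 'rV[R]_n) (a : R) (b : 'rV[R]_n) :
  mset A -> mset [set z | A (a *: z + b)%R].
Proof.
move=> mA; apply: (@mset_preimage _ _ _ (fun z => a *: z + b)%R) => //.
exact: mfunc_affine.
Qed.

Lemma mset_head n (A : set 'rV[R]_n.+1) (f : R -> 'rV[R]_n -> R) :
  mfunc (fun z : 'rV[R]_n.+1 => f (z 0%R 0%R) (vtail z)) -> mset A ->
  mset [set z : 'rV[R]_n.+1 | A (vcons (f (z 0%R 0%R) (vtail z)) (vtail z))].
Proof.
move=> mf mA.
apply: (@mset_preimage _ _ _
  (fun z : 'rV[R]_n.+1 => vcons (f (z 0%R 0%R) (vtail z)) (vtail z))) => //.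
apply: mfunc_vcons => // j.
by apply: eq_mfunc (mfunc_coord (lift ord0 j)) => z; rewrite mxE.
Qed.

Lemma volume_head_affine n (A : set 'rV[R]_n.+1) (a b : R) : (0 < a)%R ->
  mset A ->
  volume [set z : 'rV[R]_n.+1 | A (vcons (a * z 0%R 0%R + b)%R (vtail z))] =
  (a^-1)%:E * volume A.
Proof.
move=> a0 mA; apply: eq_volume_slice2 => //.
- apply: (@mset_head _ _ (fun x _ => a * x + b)%R) => //.
  apply: mfuncD; last exact: mfunc_cst.
  by apply: mfuncM; [exact: mfunc_cst|exact: mfunc_coord].
- by rewrite invr_ge0 ltW.
move=> w; rewrite -(@lebesgue_affine _ b)//; last exact: measurable_slice.
by congr (lam _); apply/seteqP; split => x /=; rewrite vcons_head vtail_cons.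
Qed.

Lemma volume_affine n (A : set 'rV[R]_n) (a : R) (b : 'rV[R]_n) : (0 < a)%R ->
  mset A -> volume [set z | A (a *: z + b)%R] = (a^-1 ^+ n)%:E * volume A.
Proof.
move=> a0; have c0 : (0 <= a^-1)%R by rewrite invr_ge0 ltW.
elim: n A b => [|n IHn] A b mA.
  rewrite expr0 mul1e; congr volume; apply/seteqP; split => z /=.
    by rewrite [(_ + _)%R]thinmx0 [z]thinmx0.
  by rewrite [(_ + _)%R]thinmx0 [z]thinmx0.
pose A' := [set z : 'rV[R]_n.+1 | A (vcons (a * z 0%R 0%R + b 0%R 0%R)%R (vtail z))].
have mA' : mset A'.
  apply: (@mset_head _ _ (fun x _ => a * x + b 0%R 0%R)%R) => //.
  apply: mfuncD; last exact: mfunc_cst.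
  by apply: mfuncM; [exact: mfunc_cst|exact: mfunc_coord].
rewrite exprSr EFinM -muleA -(@volume_head_affine _ _ _ (b 0%R 0%R))//.
apply: eq_volume_slice1 => //; first by rewrite exprn_ge0.
move=> x; rewrite -(IHn _ (vtail b)); last exact: mset_slice.
have affE y w : (a *: vcons y w + b = vcons (a * y + b 0 0) (a *: w + vtail b))%R.
  by rewrite -[X in (_ + X)%R]vcons_eta vconsZ vconsD.
congr volume; apply/seteqP.
by split => w; rewrite /A' /= affE vcons_head vtail_cons.
Qed.

Lemma volume_translate n (A : set 'rV[R]_n) (b : 'rV[R]_n) : mset A ->
  volume [set z | A (z + b)%R] = volume A.
Proof.
move=> mA; have := @volume_affine _ _ _ b (@ltr01 R) mA.
rewrite invr1 expr1n mul1e => <-.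
by congr volume; apply/seteqP; split => z /=; rewrite scale1r.
Qed.

Lemma mset_opp n (A : set 'rV[R]_n) : mset A -> mset [set z | A (- z)%R].
Proof.
move=> mA; apply: (@mset_preimage _ _ _ (fun z => - z)%R) => // i.
apply: (@eq_mfunc _ _ _ (fun z => 0 - z 0 i)%R).
  by move=> z; rewrite mxE sub0r.
by apply: mfuncB; [exact: mfunc_cst|exact: mfunc_coord].
Qed.

Lemma volume_opp n (A : set 'rV[R]_n) : mset A ->
  volume [set z | A (- z)%R] = volume A.
Proof.
elim: n A => [|n IHn] A mA.
  congr volume; apply/seteqP; split => z /=.
    by rewrite [(- _)%R]thinmx0 [z]thinmx0.
  by rewrite [(- _)%R]thinmx0 [z]thinmx0.
pose A' := [set z : 'rV[R]_n.+1 | A (vcons (- z 0%R 0%R)%R (vtail z))].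
have mA' : mset A'.
  apply: (@mset_head _ _ (fun x _ => - x)%R) => //.
  apply: (@eq_mfunc _ _ _ (fun z => 0 - z 0%R 0%R)%R); first by move=> z; rewrite sub0r.
  by apply: mfuncB; [exact: mfunc_cst|exact: mfunc_coord].
transitivity (volume A'); last first.
  rewrite -[RHS]mul1e; apply: eq_volume_slice2 => // w.
  rewrite mul1e -[RHS]lebesgue_measureN; last exact: measurable_slice.
  rewrite /pushforward; congr (lam _); apply/seteqP.
  by split => x; rewrite /A' /= vcons_head vtail_cons.
rewrite -[RHS]mul1e; apply: eq_volume_slice1 => // x.
rewrite mul1e -[RHS]IHn; last exact: mset_slice.
have oppE w : (- vcons x w = vcons (- x) (- w) :> 'rV[R]_n.+1)%R.
  by rewrite -scaleN1r vconsZ mulN1r scaleN1r.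
congr volume; apply/seteqP.
by split => w; rewrite /A' /= oppE vcons_head vtail_cons.
Qed.

(** It translates each line parallel to the first axis along itself, whereas [shear_tail] translates
    each hyperplane of constant first coordinate within itself. Invariance of the volume follows
    from Fubini in one order for the former and in the other order for the latter. *)
Definition shear_head n (k : 'rV[R]_n) (z : 'rV[R]_n.+1) : 'rV[R]_n.+1 :=
  vcons (z 0 0 + dotp k (vtail z))%R (vtail z).

Definition shear_tail n (k : 'rV[R]_n) (z : 'rV[R]_n.+1) : 'rV[R]_n.+1 :=
  vcons (z 0 0)%R (vtail z + z 0 0 *: k)%R.

Lemma mfunc_vtail n j : mfunc (fun z : 'rV[R]_n.+1 => vtail z 0%R j).
Proof. by apply: eq_mfunc (mfunc_coord (lift ord0 j)) => z; rewrite mxE. Qed.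

Lemma mset_shear_head n (k : 'rV[R]_n) (A : set 'rV[R]_n.+1) :
  mset A -> mset (shear_head k @^-1` A).
Proof.
apply: mset_preimage; apply: mfunc_vcons => [|j]; last exact: mfunc_vtail.
apply: mfuncD; first exact: mfunc_coord.
by apply: mfunc_dotp => i; [exact: mfunc_cst|exact: mfunc_vtail].
Qed.

Lemma mset_shear_tail n (k : 'rV[R]_n) (A : set 'rV[R]_n.+1) :
  mset A -> mset (shear_tail k @^-1` A).
Proof.
apply: mset_preimage; apply: mfunc_vcons => [|j]; first exact: mfunc_coord.
apply: (@eq_mfunc _ _ _
  (fun z : 'rV[R]_n.+1 => (vtail z 0 j + z 0 0 * k 0 j)%R)).
  by move=> z; rewrite !mxE.
apply: mfuncD; first exact: mfunc_vtail.
by apply: mfuncM; [exact: mfunc_coord|exact: mfunc_cst].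
Qed.

Lemma volume_shear_head n (k : 'rV[R]_n) (A : set 'rV[R]_n.+1) :
  mset A -> volume (shear_head k @^-1` A) = volume A.
Proof.
move=> mA; rewrite -[RHS]mul1e; apply: eq_volume_slice2 => //.
  exact: mset_shear_head.
move=> w; have := @lebesgue_affine 1 (dotp k w) _ ltr01 (measurable_slice w mA).
rewrite invr1 => <-; congr (lam _); apply/seteqP.
by split => x /=; rewrite /shear_head vcons_head vtail_cons mul1r.
Qed.

Lemma volume_shear_tail n (k : 'rV[R]_n) (A : set 'rV[R]_n.+1) :
  mset A -> volume (shear_tail k @^-1` A) = volume A.
Proof.
move=> mA; rewrite -[RHS]mul1e; apply: eq_volume_slice1 => // x.
rewrite mul1e -[RHS](volume_translate (x *: k))//; last exact: mset_slice.
congr volume; apply/seteqP.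
by split => w /=; rewrite /shear_tail vcons_head vtail_cons.
Qed.

End volume_maps.

(** * Volume-preserving isometries that move the pole *)

Section rotation.
Context {R : realType}.

(* A rotation in the plane of the pole and [x] is a product of three shears, and
   a shear preserves the volume by Fubini. For x_0 = -1 the coefficients are junk,
   since 1 / 0 = 0. *)
Definition rotation n (x z : 'rV[R]_n.+1) : 'rV[R]_n.+1 :=
  let k := - (1 + x 0 0)^-1 *: vtail x in
  shear_head k (shear_tail (vtail x) (shear_head k z)).

Lemma rotE n (c a : R) (y w : 'rV[R]_n) :
  rotation (vcons c y) (vcons a w) =
  let a1 := a - (1 + c)^-1 * dotp y w in
  vcons (a1 - (1 + c)^-1 * (dotp y w + a1 * dotp y y)) (w + a1 *: y).
Proof.
rewrite /rotation /shear_head /shear_tail !(vcons_head, vtail_cons) /= !dotpE.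
by rewrite !mulNr; congr (vcons _ _); ring.
Qed.

Lemma rot_linear n (x : 'rV[R]_n.+1) a z z' :
  rotation x (a *: z + z') = a *: rotation x z + rotation x z'.
Proof.
rewrite -(vcons_eta x) -(vcons_eta z) -(vcons_eta z') vconsZ vconsD !rotE/=.
rewrite vconsZ vconsD !dotpE; congr (vcons _ _); first by ring.
rewrite scalerDr addrACA; congr (_ + _).
by rewrite scalerA -scalerDl; congr (_ *: _); ring.
Qed.

Lemma rot_isometry n (x : 'rV[R]_n.+1) z : dotp x x = 1 -> 1 + x 0 0 != 0 ->
  dotp (rotation x z) (rotation x z) = dotp z z.
Proof.
rewrite -(vcons_eta x) -(vcons_eta z) vcons_head !rotE/= !dotp_cons !dotpE.
set c := x 0 0; set a := z 0 0; set y := vtail x; set w := vtail z.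
rewrite (dotpC w y); set q := dotp y w; set p := dotp y y => xx c0.
have -> : p = 1 - c * c by lra.
by field.
Qed.

Lemma rot_pole n (x : 'rV[R]_n.+1) : dotp x x = 1 -> 1 + x 0 0 != 0 ->
  rotation x (pole n) = x.
Proof.
rewrite -(vcons_eta x) vcons_head poleE rotE/= dotp_cons.
rewrite (dotpC (vtail x)) dotp0l; set p := dotp _ _; set c := x 0 0 => xx c0.
rewrite mulr0 subr0 scale1r !add0r; congr (vcons _ _).
have -> : p = 1 - c * c by lra.
by field.
Qed.

Lemma mset_rot n (x : 'rV[R]_n.+1) A : mset A -> mset (rotation x @^-1` A).
Proof.
move=> mA; rewrite /rotation /=; set k := _ *: _.
exact: (mset_shear_head k (mset_shear_tail (vtail x) (mset_shear_head k mA))).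
Qed.

Lemma volume_rot n (x : 'rV[R]_n.+1) A : mset A ->
  volume (rotation x @^-1` A) = volume A.
Proof.
move=> mA; rewrite /rotation /=; set k := _ *: _.
have m1 := mset_shear_head k mA; have m2 := mset_shear_tail (vtail x) m1.
by rewrite -(volume_shear_head k mA) -(volume_shear_tail (vtail x) m1)
  -(volume_shear_head k m2).
Qed.

Lemma rotation_to n (x : 'rV[R]_n.+1) : dotp x x = 1 ->
  exists f : 'rV[R]_n.+1 -> 'rV[R]_n.+1,
    [/\ forall a z z', f (a *: z + z') = a *: f z + f z',
        forall z, dotp (f z) (f z) = dotp z z,
        f (pole n) = x &
        forall A, mset A -> mset (f @^-1` A) /\ volume (f @^-1` A) = volume A].
Proof.
move=> xx; have [c0|c0] := boolP (1 + x 0 0 != 0).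
  exists (rotation x); split => //.
  - exact: rot_linear.
  - by move=> z; exact: rot_isometry.
  - exact: rot_pole.
  - by move=> A mA; split; [exact: mset_rot|exact: volume_rot].
(* If x_0 = -1, the pole is taken to - x, which is followed by z |-> - z. *)
have Nxx : dotp (- x) (- x) = 1 by rewrite !dotpE opprK.
have Nc0 : 1 + (- x) 0 0 != 0.
  rewrite mxE; move: c0; rewrite negbK => /eqP c0; apply/eqP => c1.
  by lra.
exists (fun z => - rotation (- x) z); split => //.
- by move=> a z z'; rewrite rot_linear opprD scalerN.
- by move=> z; rewrite !dotpE opprK rot_isometry.
- by rewrite rot_pole// opprK.
- move=> A mA; pose A' := [set z | A (- z)].
  have mA' : mset A' by exact: mset_opp.
  split; first exact: (mset_rot (- x) mA').
  exact: (etrans (volume_rot (- x) mA') (volume_opp mA)).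
Qed.

(* The inequality of norms is proved by Cauchy-Schwarz, so that surjectivity of
   [f] is not needed. *)
Lemma isometry_adjoint n (f : 'rV[R]_n -> 'rV[R]_n) (v : 'rV[R]_n) :
  (forall a z z', f (a *: z + z') = a *: f z + f z') ->
  (forall z, dotp (f z) (f z) = dotp z z) ->
  exists u, (forall z, dotp v (f z) = dotp u z) /\ dotp u u <= dotp v v.
Proof.
move=> fl fi.
have f0 : f 0 = 0 by apply/eqP; rewrite -dotp_eq0 fi dotp0l.
pose u : 'rV[R]_n := \row_j dotp v (f (delta_mx 0 j)).
have fsum (s : seq 'I_n) (z : 'rV[R]_n) :
    f (\sum_(j <- s) z 0 j *: delta_mx 0 j) =
    \sum_(j <- s) z 0 j *: f (delta_mx 0 j).
  by elim: s => [|j s IHs]; rewrite ?big_nil// !big_cons fl IHs.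
have uE z : dotp v (f z) = dotp u z.
  rewrite [in LHS](matrix_sum_delta z) big_ord1 fsum /dotp.
  under eq_bigr do rewrite summxE mulr_sumr.
  rewrite exchange_big/=; apply: eq_bigr => j _; rewrite mxE mulrC mulr_sumr.
  by apply: eq_bigr => i _; rewrite mxE mulrCA.
exists u; split => //.
have := dotp_CS v (f u); rewrite uE fi expr2.
have [->//|u0] := eqVneq (dotp u u) 0; first by rewrite dotp_ge0.
by rewrite ler_pM2r// lt_neqAle eq_sym u0 dotp_ge0.
Qed.

End rotation.

(** * Real-valued volume and Euclidean balls *)

Section real_volume.
Context {R : realType}.
Local Notation T := (measurableTypeR R).
Local Notation lam := (@lebesgue_measure R).

Definition vol n (A : set 'rV[R]_n) : R := fine (volume A).

(** It bundles what is needed to treat a volume as a real number and to stay within real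
    arithmetic. *)
Definition fvol n (A : set 'rV[R]_n) := mset A /\ volume A \is a fin_num.

Lemma fvolE n (A : set 'rV[R]_n) : fvol A -> volume A = (vol A)%:E.
Proof. by move=> [_ ?]; rewrite fineK. Qed.

Lemma vol_ge0 n (A : set 'rV[R]_n) : 0 <= vol A.
Proof. by apply: fine_ge0; exact: volume_ge0. Qed.

Lemma fvol_sub n (A B : set 'rV[R]_n) : mset A -> fvol B -> A `<=` B -> fvol A.
Proof.
move=> mA [mB fB] AB; split => //.
rewrite ge0_fin_numE ?volume_ge0//; apply: le_lt_trans (le_volume mA mB AB) _.
by rewrite -ge0_fin_numE ?volume_ge0.
Qed.

Lemma le_vol n (A B : set 'rV[R]_n) : mset A -> fvol B -> A `<=` B ->
  vol A <= vol B.
Proof.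
move=> mA fB AB; have fA := fvol_sub mA fB AB.
by rewrite -lee_fin -!fvolE//; apply: le_volume => //; case: fB.
Qed.

Lemma vol_set0 n : vol (set0 : set 'rV[R]_n) = 0.
Proof. by rewrite /vol volume0. Qed.

Lemma fvolU n (A B : set 'rV[R]_n) : fvol A -> fvol B -> fvol (A `|` B).
Proof.
move=> [mA fA] [mB fB]; split; first exact: msetU.
rewrite ge0_fin_numE ?volume_ge0//; apply: le_lt_trans (volumeU_le mA mB) _.
by rewrite lte_add_pinfty// -ge0_fin_numE ?volume_ge0.
Qed.

Lemma volU n (A B : set 'rV[R]_n) : fvol A -> fvol B -> A `&` B = set0 ->
  vol (A `|` B) = vol A + vol B.
Proof.
move=> fA fB AB; have [mA ?] := fA; have [mB ?] := fB.
by rewrite /vol volumeU// fineD.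
Qed.

Lemma volU_le n (A B : set 'rV[R]_n) : fvol A -> fvol B ->
  vol (A `|` B) <= vol A + vol B.
Proof.
move=> fA fB; rewrite -lee_fin EFinD -!fvolE//; last exact: fvolU.
by apply: volumeU_le; [case: fA|case: fB].
Qed.

Lemma volD n (A B : set 'rV[R]_n) : fvol A -> mset B -> B `<=` A ->
  vol (A `\` B) = vol A - vol B.
Proof.
move=> fA mB BA; have fB := fvol_sub mB fA BA; have [mA _] := fA.
have fAB : fvol (A `\` B) by apply: fvol_sub fA _; [exact: msetD|exact: subDsetl].
rewrite -[in RHS](setDUK BA) volU//; first by rewrite addrC addKr.
by rewrite setDIK.
Qed.

Lemma fvol_affine n (A : set 'rV[R]_n) (a : R) (b : 'rV[R]_n) :
  0 < a -> fvol A -> fvol [set z | A (a *: z + b)].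
Proof.
move=> a0 [mA fA]; split; first exact: mset_affine.
by rewrite volume_affine// fin_numM.
Qed.

Lemma vol_affine n (A : set 'rV[R]_n) (a : R) (b : 'rV[R]_n) :
  0 < a -> fvol A -> vol [set z | A (a *: z + b)] = a^-1 ^+ n * vol A.
Proof. by move=> a0 [mA fA]; rewrite /vol volume_affine// fineM. Qed.

Lemma vol_translate n (A : set 'rV[R]_n) (b : 'rV[R]_n) : mset A ->
  vol [set z | A (z + b)] = vol A.
Proof. by move=> mA; rewrite /vol volume_translate. Qed.

Lemma vol_head_affine n (A : set 'rV[R]_n.+1) (a b : R) : 0 < a -> fvol A ->
  vol [set z : 'rV[R]_n.+1 | A (vcons (a * z 0 0 + b) (vtail z))] =
  a^-1 * vol A.
Proof. by move=> a0 [mA fA]; rewrite /vol volume_head_affine// fineM. Qed.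

Lemma le_vol_slice1 n (A B : set 'rV[R]_n.+1) (c : R) :
  fvol A -> fvol B -> 0 <= c ->
  (forall x, (volume [set w | A (vcons x w)] <=
             c%:E * volume [set w | B (vcons x w)])%E) ->
  vol A <= c * vol B.
Proof.
move=> fA fB c0 AB; rewrite -lee_fin EFinM -!fvolE//.
by apply: le_volume_slice1 => //; [case: fA|case: fB].
Qed.

(** The parameter is the square of the radius, possibly negative: the slice at height x is then
    again a ball, with parameter r - x^2. *)
Definition euball n (r : R) : set 'rV[R]_n := [set z | dotp z z <= r].
Arguments euball : clear implicits.

Lemma mfunc_normsq n : mfunc (fun z : 'rV[R]_n => dotp z z).
Proof. by apply: mfunc_dotp => i; exact: mfunc_coord. Qed.

Lemma mset_euball n r : mset (euball n r).
Proof. by apply: mset_le; [exact: mfunc_normsq|exact: mfunc_cst]. Qed.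

Lemma slice_euball n r x :
  [set w | euball n.+1 r (vcons x w)] = euball n (r - x ^+ 2).
Proof.
by apply/seteqP; split => w /=; rewrite /euball /= dotp_cons expr2 => ?; lra.
Qed.

Lemma euball_lt0 n (r : R) : r < 0 -> euball n r = set0.
Proof.
move=> r0; apply/seteqP; split => // z; rewrite /euball /= => zr.
by have := dotp_ge0 z; lra.
Qed.

Lemma volume_euball_scale n (r : R) : 0 < r ->
  (volume (euball n (r ^+ 2)) = (r ^+ n)%:E * volume (euball n 1))%E.
Proof.
move=> r0; have ri : 0 < r^-1 by rewrite invr_gt0.
have := volume_affine 0 ri (mset_euball 1); rewrite invrK => <-.
congr volume; apply/seteqP; split => z;
  rewrite /euball /= addr0 !dotpE mulrA -expr2 exprVn mulrC
    ler_pdivrMr ?exprn_gt0// mul1r//.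
Qed.

(** By induction on the dimension: the slice at x lies in the unit ball if |x| <= 1 and is empty
    otherwise. *)
Lemma fvol_euball1 n : fvol (euball n 1).
Proof.
split; first exact: mset_euball.
elim: n => [|n IHn].
  by rewrite volumeE /= diracE.
rewrite ge0_fin_numE ?volume_ge0// volume_slice1.
have cE : (volume (euball n 1) = (vol (euball n 1))%:E)%E by rewrite fineK.
apply: (@le_lt_trans _ _ (\int[lam]_x
   ((vol (euball n 1))%:E * (\1_(`[-1, 1]%classic : set T) x)%:E))%E).
  apply: ge0_le_integral => //.
  - apply: measurable_volume_slice; exact: mset_euball.
  - by apply: measurable_funeM; apply/measurable_EFinP; exact: measurable_indic.
  move=> x _; rewrite slice_euball indicE.
  have [x1|x1] := leP 0 (1 - x ^+ 2).
    rewrite mem_set ?mule1 -?cE; last first.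
      by rewrite /= in_itv/=; apply/andP; split; nra.
    apply: le_volume; [exact: mset_euball|exact: mset_euball|move=> z].
    by rewrite /euball /=; nra.
  by rewrite euball_lt0// volume0 mule_ge0// lee_fin// vol_ge0.
have mI : measurable_fun setT
    (fun x : T => (\1_(`[(-1)%R, 1%R]%classic : set T) x : R)%:E).
  by apply/measurable_EFinP; exact: measurable_indic.
rewrite ge0_integralZl//; last by rewrite lee_fin vol_ge0.
rewrite integral_indic// setIT /= lebesgue_measure_itv/= lte_fin.
by case: ifP => _; rewrite ?mule0 -?EFinD -?EFinM ltry.
Qed.

Lemma fvol_euball n r : fvol (euball n r).
Proof.
have [r0|r0] := leP r 0.
  apply: fvol_sub (fvol_euball1 n) _; first exact: mset_euball.
  by move=> z; rewrite /euball /=; lra.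
split; first exact: mset_euball.
rewrite -(sqr_sqrtr (ltW r0)) volume_euball_scale ?sqrtr_gt0//.
by rewrite fin_numM//; case: (fvol_euball1 n).
Qed.

(** By induction again: the slices at 0 <= x <= 1/2 contain a ball of radius 1/2. *)
Lemma vol_euball1_gt0 n : 0 < vol (euball n 1).
Proof.
rewrite -lte_fin -fvolE; last exact: fvol_euball1.
elim: n => [|n IHn].
  by rewrite volumeE /= diracE mem_set ?lte_fin//= /euball /= /dotp big_ord0.
have h2 : (0 : R) < 2^-1 by rewrite invr_gt0.
pose c : \bar R := volume (euball n (2^-1 ^+ 2)).
have c0 : (0 < c)%E.
  by rewrite /c volume_euball_scale// mule_gt0// lte_fin exprn_gt0.
apply: (@lt_le_trans _ _ (\int[lam]_x
   (c * (\1_(`[0, 2^-1]%classic : set T) x)%:E))%E).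
  have mI : measurable_fun setT
      (fun x : T => (\1_(`[0%R, (2^-1)%R]%classic : set T) x : R)%:E).
    by apply/measurable_EFinP; exact: measurable_indic.
  rewrite ge0_integralZl//; last exact: ltW.
  rewrite integral_indic// setIT /= lebesgue_measure_itv/= lte_fin h2.
  by rewrite oppr0 adde0 mule_gt0// lte_fin.
rewrite volume_slice1; apply: ge0_le_integral => //.
- by move=> x _; rewrite mule_ge0// ltW.
- by apply: measurable_funeM; apply/measurable_EFinP; exact: measurable_indic.
- by apply: measurable_volume_slice; exact: mset_euball.
move=> x _; rewrite slice_euball indicE.
have [x1|x1] := boolP (x \in _); last by rewrite mule0 volume_ge0.
rewrite mule1; apply: le_volume; [exact: mset_euball|exact: mset_euball|].
move: x1; rewrite inE /= in_itv/= => /andP[x1 x2] z; rewrite /euball /=.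
by nra.
Qed.

End real_volume.

Arguments euball {R} n r _ : simpl never.

(** * Volumes of cones over caps *)

Section cones.
Context {R : realType}.

Lemma ler_sqr_nneg (x y : R) : 0 <= y -> x ^+ 2 <= y ^+ 2 -> x <= y.
Proof. by move=> y0 xy; rewrite leNgt; apply/negP => yx; nra. Qed.

Lemma volume_euball_le n (r r' c : R) : 0 < c -> r <= c ^+ 2 * r' ->
  (volume (euball n r) <= (c ^+ n)%:E * volume (euball n r'))%E.
Proof.
move=> c0 rr'; have ci : 0 < c^-1 by rewrite invr_gt0.
have := volume_affine 0 ci (mset_euball r'); rewrite invrK => <-.
apply: le_volume; first exact: mset_euball.
  exact: (mset_affine _ _ (mset_euball r')).
move=> z; rewrite /euball /= addr0 !dotpE => zr.
by rewrite mulrA -expr2 exprVn mulrC ler_pdivrMr ?exprn_gt0// mulrC; lra.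
Qed.

(* The cone over the cap {y : y_0 >= t} of the sphere, for t >= 0; squaring the
   condition z_0 >= t |z| makes it polynomial. *)
Definition scone n (t : R) : set 'rV[R]_n.+1 :=
  [set z | [/\ dotp z z <= 1, 0 <= z 0 0 & t ^+ 2 * dotp z z <= z 0 0 ^+ 2]].
Arguments scone : clear implicits.

Lemma mset_scone n t : mset (scone n t).
Proof.
rewrite (_ : scone n t = [set z | dotp z z <= 1] `&` [set z | 0 <= z 0 0] `&`
  [set z | t ^+ 2 * dotp z z <= z 0 0 ^+ 2]); last first.
  by apply/seteqP; split => z /=; [case|case; case].
apply: msetI; first apply: msetI.
- exact: mset_euball.
- by apply: mset_le; [exact: mfunc_cst|exact: mfunc_coord].
- apply: mset_le; last by apply: mfuncX; exact: mfunc_coord.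
  by apply: mfuncM; [exact: mfunc_cst|exact: mfunc_normsq].
Qed.

Lemma fvol_scone n t : fvol (scone n t).
Proof.
by apply: fvol_sub (fvol_euball _ 1) _; [exact: mset_scone|move=> z []].
Qed.

Lemma scone_neg n (t x : R) : x < 0 -> [set w | scone n t (vcons x w)] = set0.
Proof.
move=> x0; apply/seteqP; split => // w [_]; rewrite vcons_head; lra.
Qed.

(** This is the squared radius of the slice of [scone] at height x. The first term comes from the
    unit ball and the second from the cone; they meet at x = t, where the maximum 1 - t^2 is
    attained. *)
Definition slice_radius (t x : R) : R :=
  Num.min (1 - x ^+ 2) (x ^+ 2 * ((1 - t ^+ 2) / t ^+ 2)).

Lemma slice_scone n (t x : R) : 0 < t -> 0 <= x ->
  [set w | scone n t (vcons x w)] = euball n (slice_radius t x).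
Proof.
move=> t0 x0; apply/seteqP; split => w; rewrite /scone /euball /slice_radius /=;
  rewrite vcons_head dotp_cons le_min.
  move=> [h1 _ h2]; apply/andP; split; first by nra.
  by rewrite mulrA ler_pdivlMr ?exprn_gt0//; nra.
move=> /andP[h1]; rewrite mulrA ler_pdivlMr ?exprn_gt0// => h2.
by split => //; nra.
Qed.

Lemma slice_radius_le (t x : R) : 0 < t -> t <= 1 -> 0 <= x ->
  slice_radius t x <= 1 - t ^+ 2.
Proof.
move=> t0 t1 x0; rewrite /slice_radius ge_min; have [tx|xt] := leP t x.
  by apply/orP; left; nra.
apply/orP; right; rewrite mulrCA.
have h : x ^+ 2 / t ^+ 2 <= 1.
  by rewrite ler_pdivrMr ?exprn_gt0// mul1r; nra.
have h' : 0 <= 1 - t ^+ 2 by nra.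
by rewrite -[leRHS]mulr1 ler_wpM2l.
Qed.

(* The halfspace cuts from the ball of radius p = sqrt r a subset of the ball of
   center s p v and radius q p. *)
Lemma volume_euball_halfspace n (v : 'rV[R]_n) (r S s q : R) :
  dotp v v <= 1 -> 0 <= s -> 0 < q -> q ^+ 2 = 1 - s ^+ 2 -> 0 <= S ->
  r <= S ^+ 2 ->
  (volume (euball n r `&` [set w | (s * S <= dotp v w)%R]) <=
   (q ^+ n)%:E * volume (euball n r))%E.
Proof.
move=> v1 s0 q0 qs S0 rS; have [r0|r0] := ltP r 0.
  by rewrite euball_lt0// set0I volume0 mule0.
have qi : 0 < q^-1 by rewrite invr_gt0.
pose p := Num.sqrt r; have p0 : 0 <= p by exact: sqrtr_ge0.
have pp : p ^+ 2 = r by exact: sqr_sqrtr.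
have pS : p <= S by apply: ler_sqr_nneg => //; rewrite pp.
have := volume_affine (- (s * p / q) *: v) qi (mset_euball r).
rewrite invrK => <-; apply: le_volume.
- apply: msetI; first exact: mset_euball.
  apply: mset_le; first exact: mfunc_cst.
  by apply: mfunc_dotp => i; [exact: mfunc_cst|exact: mfunc_coord].
- exact: (mset_affine _ _ (mset_euball r)).
move=> w [wr sw]; rewrite /euball /= in wr sw *.
rewrite !dotpE (dotpC w v).
rewrite [leLHS](_ : _ = (dotp w w - 2 * (s * p) * dotp v w +
  (s * p) ^+ 2 * dotp v v) / q ^+ 2); last by field; rewrite gt_eqF.
rewrite ler_pdivrMr ?exprn_gt0// qs -pp.
have sp : s * p <= dotp v w by apply: le_trans sw; rewrite ler_wpM2l.
have sp0 : 0 <= s * p by exact: mulr_ge0.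
have h1 : (s * p) ^+ 2 * dotp v v <= (s * p) ^+ 2.
  by rewrite ler_piMr ?sqr_ge0.
have h2 : (s * p) * (s * p) <= (s * p) * dotp v w by rewrite ler_wpM2l.
have h3 : (s * p) * (s * p) = s ^+ 2 * p ^+ 2 by ring.
rewrite -pp in wr; move: h1 h2 h3; rewrite expr2.
by move: (dotp v v) (dotp v w) (dotp w w) (s * p) wr => V b W a *; nra.
Qed.

(** No slice has a radius above S = sqrt (1 - t^2), so [volume_euball_halfspace] applies to all of
    them with the same q. This is the source of the subgaussian tails. *)
Lemma vol_scone_halfspace n (v : 'rV[R]_n) (t s q : R) :
  dotp v v <= 1 -> 0 < t <= 1 -> 0 <= s -> 0 < q -> q ^+ 2 = 1 - s ^+ 2 ->
  vol (scone n t `&` [set z | s * Num.sqrt (1 - t ^+ 2) <= dotp v (vtail z)])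
  <= q ^+ n * vol (scone n t).
Proof.
move=> v1 /andP[t0 t1] s0 q0 qs.
set S := Num.sqrt _; have S2 : S ^+ 2 = 1 - t ^+ 2.
  by rewrite sqr_sqrtr// subr_ge0 expr_le1// ltW.
have S0 : 0 <= S by exact: sqrtr_ge0.
apply: le_vol_slice1.
- apply: fvol_sub (fvol_scone n t) _; last exact: subIsetl.
  apply: msetI; first exact: mset_scone.
  apply: mset_le; first exact: mfunc_cst.
  by apply: mfunc_dotp => i; [exact: mfunc_cst|exact: mfunc_vtail].
- exact: fvol_scone.
- by rewrite exprn_ge0// ltW.
move=> x; have [x0|x0] := ltP x 0.
  rewrite (_ : [set w | _] = set0) ?volume0 ?mule_ge0 ?volume_ge0 ?lee_fin//.
    by rewrite exprn_ge0// ltW.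
  apply/seteqP; split => // w [].
  by have /seteqP[h _] := scone_neg n t x0 => /(h w).
rewrite slice_scone//.
have := @volume_euball_halfspace n v (slice_radius t x) S s q v1 s0 q0 qs S0.
rewrite S2 => /(_ (slice_radius_le t0 t1 x0)); apply: le_trans.
rewrite le_eqVlt; apply/orP; left; apply/eqP; congr volume.
have /seteqP[h1 h2] := slice_scone n t0 x0.
by apply/seteqP; split => w [h]; rewrite /= ?vtail_cons => k; split;
  rewrite /= ?vtail_cons//; [exact: h1|exact: h2].
Qed.

End cones.

Arguments scone {R} n t _ : simpl never.

(** * Shrinking a cap costs a constant factor of the volume *)

Section shrink.
Context {R : realType}.

Lemma bernoulli (x : R) n : 0 <= x -> x <= 1 -> 1 - n%:R * x <= (1 - x) ^+ n.
Proof.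
move=> x0 x1; elim: n => [|n IHn]; first by rewrite expr0 mul0r subr0.
rewrite exprSr -natr1; set p := (1 - x) ^+ n in IHn *.
have n0 : 0 <= n%:R :> R by [].
set m := n%:R in IHn n0 *.
have h := ler_wpM2r (_ : 0 <= 1 - x) IHn.
have : (1 - m * x) * (1 - x) <= p * (1 - x) by apply: h; lra.
have : 0 <= m * (x * x) by rewrite !mulr_ge0.
nra.
Qed.

Lemma bernoulli_upper (x : R) n : 0 <= x -> x <= 1 ->
  (1 - x) ^+ n * (1 + n%:R * x) <= 1.
Proof.
move=> x0 x1; elim: n => [|n]; first by rewrite expr0 mul0r addr0 mul1r.
apply: le_trans; rewrite exprSr -natr1 -mulrA ler_wpM2l ?exprn_ge0 ?subr_ge0//.
have n0 : 0 <= n%:R :> R by [].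
set m := n%:R in n0 *.
have : 0 <= m * (x * x) by rewrite !mulr_ge0.
nra.
Qed.

Lemma expr_inv_bernoulli (c2 x : R) (n : nat) : 0 <= x -> n%:R * x <= 2^-1 ->
  0 < c2 -> (1 - x) * c2 <= 1 -> x <= 1 -> c2 ^+ n <= 2.
Proof.
move=> x0 nx c20 xc x1.
have h1 := bernoulli n x0 x1.
have h2 : (1 - x) ^+ n * c2 ^+ n <= 1.
  by rewrite -exprMn exprn_ile1// mulr_ge0 ?subr_ge0// ltW.
have h3 : 0 <= c2 ^+ n by rewrite exprn_ge0 // ltW.
have h4 : 2^-1 * c2 ^+ n <= (1 - x) ^+ n * c2 ^+ n by rewrite ler_wpM2r//; lra.
lra.
Qed.

Lemma sqrt_expr_le (c2 : R) n : 1 <= c2 -> Num.sqrt c2 ^+ n <= c2 ^+ n.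
Proof.
move=> c1; have c0 : 0 <= c2 by lra.
have s1 : 1 <= Num.sqrt c2 by rewrite -{1}sqrtr1 ler_wsqrtr.
apply: lerXn2r; rewrite ?nnegrE ?sqrtr_ge0//.
rewrite -{2}(sqr_sqrtr c0) expr2; nra.
Qed.

(* For t bounded away from 0, contract the slices orthogonal to the pole. *)
Lemma vol_scone_shrink_large d (t t' : R) : (0 < d)%N -> 0 < t < 1 ->
  0 <= t' -> t' ^+ 2 = t ^+ 2 + (1 - t ^+ 2) / (16 * d%:R) -> 2^-1 <= t ^+ 2 ->
  vol (scone d t) <= 2 * vol (scone d t').
Proof.
move=> d0 /andP[t0 t1] t'0 t'E t2.
have dR : 1 <= d%:R :> R by rewrite ler1n.
pose u : R := (16 * d%:R)^-1.
have u0 : 0 < u by rewrite invr_gt0; lra.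
have du : d%:R * u = 16^-1 by rewrite /u; field; rewrite gt_eqF//; lra.
have u1 : u <= 16^-1 by nra.
have {}t'E : t' ^+ 2 = t ^+ 2 + (1 - t ^+ 2) * u by [].
have T0 : 0 < 1 - t ^+ 2 by nra.
have T'0 : 0 < 1 - t' ^+ 2 by rewrite t'E; nra.
have t'p : 0 < t' ^+ 2 by rewrite t'E; nra.
have {t'p}t'p : 0 < t'.
  by rewrite lt_neqAle t'0 andbT; apply/eqP => h; move: t'p; rewrite -h expr0n ltxx.
(* The square of the ratio of the apertures of the two cones. It equals t'^2 / (t^2 (1 - u)), which
   is at most (1 + u) / (1 - u) because 1 - t^2 <= t^2. *)
pose c2 := ((1 - t ^+ 2) / t ^+ 2) / ((1 - t' ^+ 2) / t' ^+ 2).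
have nz : [/\ t ^+ 2 != 0, t' ^+ 2 != 0, 1 - t ^+ 2 != 0 & 1 - t' ^+ 2 != 0].
  by rewrite !expf_eq0 /= !gt_eqF.
have [nz1 nz2 nz3 nz4] := nz.
have c2E : c2 * (t ^+ 2 * (1 - u)) = t' ^+ 2.
  have -> : 1 - u = (1 - t' ^+ 2) / (1 - t ^+ 2).
    by rewrite t'E; field.
  by rewrite /c2; field; rewrite nz3 nz4 !gt_eqF.
have c20 : 0 < c2 by rewrite !divr_gt0 ?exprn_gt0.
have c21 : 1 <= c2.
  have a0 : 0 < t ^+ 2 * (1 - u) by rewrite mulr_gt0 ?exprn_gt0//; lra.
  by rewrite -(ler_pM2r a0) c2E mul1r t'E; nra.
have c2d : Num.sqrt c2 ^+ d <= 2.
  apply: le_trans (sqrt_expr_le d c21) _.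
  apply: (@expr_inv_bernoulli _ (4 * u)) => //; [lra|lra| |lra].
  have a0 : 0 < t ^+ 2 * (1 - u) by rewrite mulr_gt0 ?exprn_gt0//; lra.
  rewrite -(ler_pM2r a0) -mulrA c2E mul1r t'E.
  have hh : (1 - t ^+ 2) * u <= t ^+ 2 * u by apply: ler_wpM2r; [exact: ltW|lra].
  have tt : 0 <= t ^+ 2 by lra.
  have : 0 <= t ^+ 2 * u by rewrite mulr_ge0// ltW.
  have : 0 <= t ^+ 2 * u * u by rewrite !mulr_ge0// ltW.
  move: hh; set q := t ^+ 2; move=> *; nra.
apply: le_trans (_ : Num.sqrt c2 ^+ d * vol (scone d t') <= _); last first.
  by rewrite ler_wpM2r// vol_ge0.
apply: le_vol_slice1; [exact: fvol_scone|exact: fvol_scone| |].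
  by rewrite exprn_ge0// sqrtr_ge0.
move=> x; have [x0|x0] := ltP x 0; first by rewrite !scone_neg// !volume0 mule0.
rewrite !slice_scone//.
have [x1|x1] := ltP (1 - x ^+ 2) 0.
  rewrite euball_lt0 ?volume0 ?mule_ge0 ?volume_ge0 ?lee_fin ?exprn_ge0//.
  by rewrite /slice_radius gt_min x1.
apply: volume_euball_le; first by rewrite sqrtr_gt0.
rewrite sqr_sqrtr ?(ltW c20)// /slice_radius minr_pMr ?(ltW c20)//.
rewrite le_min !ge_min; apply/andP; split; apply/orP; [left|right].
  by nra.
rewrite le_eqVlt; apply/orP; left; apply/eqP; rewrite /c2; field.
by rewrite nz4 !gt_eqF.
Qed.

Lemma shrunk_height (D t t' : R) : 1 <= D -> 0 < t < 1 -> 0 <= t' ->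
  t' ^+ 2 = t ^+ 2 + (1 - t ^+ 2) / (16 * D) -> t < t' < 1.
Proof.
move=> D1 /andP[t0 t1] t'0; have u0 : 0 < (16 * D)^-1 by rewrite invr_gt0; lra.
have u1 : (16 * D)^-1 < 1 by rewrite invf_lt1; lra.
move: ((16 * D)^-1) u0 u1 => u u0 u1 t'E.
have T0 : 0 < 1 - t ^+ 2 by nra.
have h1 : 0 < (1 - t ^+ 2) * u by rewrite mulr_gt0.
have h2 : 0 < (1 - t ^+ 2) * (1 - u) by rewrite mulr_gt0// subr_gt0.
by apply/andP; split; rewrite ltNge; apply/negP => h; nra.
Qed.

(** With e = t' - t, the lifted height is at most t + 2 e + t u. In the expansion of its square the
    excess over t^2 splits into 4 (e^2 + e t), at most 4 (1 - t^2) u since e^2 + 2 e t = (1 - t^2)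
    u, and into the terms [y2] and [y3], at most 3 and 1 times (1 - t^2) u; hence the 8. *)
Lemma shift_bound (t t' u x : R) : 0 < t -> t < t' -> 0 < u -> u <= 16^-1 ->
  t' ^+ 2 = t ^+ 2 + (1 - t ^+ 2) * u -> t ^+ 2 <= 2^-1 ->
  t - t * u <= x -> x <= t' -> let b := t' - (t - t * u) in
  [/\ 0 <= x, t' <= x + b & (1 - 8 * u) * (1 - t ^+ 2) <= 1 - (x + b) ^+ 2].
Proof.
move=> t0 tt' u0 u1 t'E t2 xl xr b.
have ht : t * u <= t * 16^-1 by rewrite ler_pM2l.
have tu : 0 < t * u by rewrite mulr_gt0.
split; [lra|rewrite /b; lra|].
have [e e0 eE] : exists2 e, 0 < e & t' = t + e by exists (t' - t); lra.
have {}t'E : e ^+ 2 + 2 * (e * t) = (1 - t ^+ 2) * u.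
  by move: t'E; rewrite eE; lra.
have y1 : (x + b) ^+ 2 <= (t + (2 * e + t * u)) ^+ 2.
  have h1 : 0 <= x + b by rewrite /b; lra.
  have h2 : x + b <= t + (2 * e + t * u) by rewrite /b; lra.
  by apply: lerXn2r; rewrite ?nnegrE; lra.
have et : 0 <= e * t by rewrite mulr_ge0// ltW.
have ee := sqr_ge0 e.
have tq : 0 < t ^+ 2 by rewrite exprn_gt0.
have y2 : 2 * (t * u) * t + (t * u) ^+ 2 <= 3 * ((1 - t ^+ 2) * u).
  have -> : 2 * (t * u) * t + (t * u) ^+ 2 = t ^+ 2 * (2 * u + u ^+ 2) by ring.
  have h1 : t ^+ 2 * (2 * u + u ^+ 2) <= t ^+ 2 * (3 * u).
    by rewrite ler_pM2l//; move: u0 u1; clear; nra.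
  have h2 : t ^+ 2 * u <= (1 - t ^+ 2) * u by rewrite ler_pM2r//; move: t2; clear; lra.
  by move: h1 h2; clear; lra.
have y3 : 4 * (e * (t * u)) <= (1 - t ^+ 2) * u.
  have h1 : e * (t * u) <= e * (t * 16^-1) by rewrite ler_pM2l.
  by move: h1 et ee t'E; clear; lra.
by move: y1 y2 y3 et ee t'E; clear; lra.
Qed.

Lemma homothety_factor (u : R) d : 0 < u -> u <= 16^-1 -> d%:R * u = 16^-1 ->
  (1 - u) ^+ d.+1 * (1 + 16^-1) <= 1.
Proof.
move=> u0 u1 du; have u2 : u <= 1 by lra.
apply: le_trans (bernoulli_upper d.+1 (ltW u0) u2).
have du1 : d.+1%:R * u = 16^-1 + u by rewrite -natr1 mulrDl du mul1r.
have k0 : 0 <= (1 - u) ^+ d.+1 by rewrite exprn_ge0//; lra.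
by rewrite ler_wpM2l// du1; lra.
Qed.

(** The 16 in u = 1 / (16 d) makes d (8 u) = 1/2, for which Bernoulli's inequality leaves a factor
    of at most 2. *)
Lemma contraction_factor (u : R) d : 0 < u -> u <= 16^-1 -> d%:R * u = 16^-1 ->
  0 < (1 - 8 * u)^-1 /\ Num.sqrt (1 - 8 * u)^-1 ^+ d <= 2.
Proof.
move=> u0 u1 du; have p0 : 0 < 1 - 8 * u by lra.
have c0 : 0 < (1 - 8 * u)^-1 by rewrite invr_gt0.
split => //; apply: le_trans (sqrt_expr_le d _) _.
  by rewrite invf_ge1//; lra.
apply: (@expr_inv_bernoulli _ (8 * u)) => //; [lra|lra| |lra].
by rewrite mulfV// gt_eqF.
Qed.

(* For t possibly close to 0, the part of the cone with z_0 near t is shifted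
   upwards into the smaller cone, and the part below is a homothetic copy that
   represents a bounded multiple of it. *)
Lemma vol_scone_shrink_small d (t t' : R) : (0 < d)%N -> 0 < t < 1 ->
  0 <= t' -> t' ^+ 2 = t ^+ 2 + (1 - t ^+ 2) / (16 * d%:R) -> t ^+ 2 <= 2^-1 ->
  vol (scone d t) <= 35 * vol (scone d t').
Proof.
move=> d0 /andP[t0 t1] t'0 t'E t2.
have dR : 1 <= d%:R :> R by rewrite ler1n.
pose u : R := (16 * d%:R)^-1.
have u0 : 0 < u by rewrite invr_gt0; lra.
have du : d%:R * u = 16^-1 by rewrite /u; field; rewrite gt_eqF//; lra.
have u1 : u <= 16^-1 by nra.
have t'E2 : t' ^+ 2 = t ^+ 2 + (1 - t ^+ 2) * u by [].
have tq : 0 < t ^+ 2 by rewrite exprn_gt0.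
have t01 : 0 < t < 1 by rewrite t0.
have /andP[tt' t'1] := shrunk_height dR t01 t'0 t'E.
have t'p : 0 < t' by exact: lt_trans tt'.
(* Contraction by 1 - u takes the height t to t - h, so that the part [X3] below t - h lies in the
   contracted copy of [Y]; the shift b takes t - h to t'. *)
pose h := t * u; pose b := t' - (t - h).
have h0 : 0 < h by rewrite mulr_gt0.
pose X1 := scone d t `&` [set z | t' <= z 0 0].
pose X2 := scone d t `&` [set z | t - h <= z 0 0] `&` [set z | z 0 0 <= t'].
pose X3 := scone d t `&` [set z | z 0 0 <= t - h].
pose Y := scone d t `&` [set z | z 0 0 <= t].
have mge (c : R) : mset [set z : 'rV[R]_d.+1 | c <= z 0 0].
  by apply: mset_le; [exact: mfunc_cst|exact: mfunc_coord].
have mle (c : R) : mset [set z : 'rV[R]_d.+1 | z 0 0 <= c].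
  by apply: mset_le; [exact: mfunc_coord|exact: mfunc_cst].
have fsub (A : set 'rV[R]_d.+1) : mset A -> fvol (scone d t `&` A).
  move=> mA; apply: fvol_sub (fvol_scone d t) _; last exact: subIsetl.
  by apply: msetI => //; exact: mset_scone.
have fX1 : fvol X1 by exact: (fsub _ (mge _)).
have fX2 : fvol X2 by rewrite /X2 -setIA; exact: (fsub _ (msetI (mge _) (mle _))).
have fX3 : fvol X3 by exact: (fsub _ (mle _)).
have fY : fvol Y by exact: (fsub _ (mle _)).
have hX1 : vol X1 <= vol (scone d t').
  apply: le_vol; [by case: fX1|exact: fvol_scone|].
  move=> z [[z1 z2 z3] /= z4]; split => //.
  have := dotp_ge0 z; have : t' ^+ 2 <= z 0 0 ^+ 2 by nra.
  by have := sqr_ge0 t'; nra.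
have hX3 : vol X3 <= (1 - u) ^+ d.+1 * vol Y.
  have a0 : 0 < (1 - u)^-1 by rewrite invr_gt0; lra.
  have := vol_affine 0 a0 fY; rewrite invrK => <-.
  apply: le_vol; [by case: fX3|exact: fvol_affine|].
  move=> z [[z1 z2 z3] /= z4]; rewrite /= addr0.
  have v0 : 0 < 1 - u by lra.
  have z5 : (1 - u)^-1 * z 0 0 <= t.
    by rewrite mulrC ler_pdivrMr//; move: z4; rewrite /h; lra.
  have z6 : 0 <= (1 - u)^-1 * z 0 0 by rewrite mulr_ge0// ltW.
  have z7 : t ^+ 2 * dotp ((1 - u)^-1 *: z) ((1 - u)^-1 *: z) <=
            ((1 - u)^-1 *: z) 0 0 ^+ 2.
    rewrite !dotpE mxE exprMn.
    rewrite [leLHS](_ : _ = (1 - u)^-1 ^+ 2 * (t ^+ 2 * dotp z z)); last by ring.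
    by rewrite ler_wpM2l// sqr_ge0.
  have yE : ((1 - u)^-1 *: z) 0 0 = (1 - u)^-1 * z 0 0 by rewrite mxE.
  rewrite -yE in z5 z6; move: ((1 - u)^-1 *: z) z5 z6 z7 {yE} => y z5 z6 z7.
  split => //; split => //; rewrite -(ler_pM2l tq) mulr1.
  by apply: le_trans z7 _; nra.
have hY : vol Y <= vol X2 + vol X3.
  apply: le_trans (volU_le fX2 fX3); apply: le_vol; [by case: fY|exact: fvolU|].
  move=> z [zt /= zle]; have [zh|zh] := leP (z 0 0) (t - h); first by right; split.
  by left; split => /=; [split => //=; exact: ltW|lra].
have hX : vol (scone d t) <= vol X1 + (vol X2 + vol X3).
  have fU : fvol (X2 `|` X3) by exact: fvolU.
  apply: le_trans (_ : vol (X1 `|` (X2 `|` X3)) <= _).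
    apply: le_vol; [exact: mset_scone|by apply: fvolU|].
    move=> z zt; have [z1|z1] := leP t' (z 0 0); first by left; split.
    right; have [zh|zh] := leP (z 0 0) (t - h); first by right; split.
    by left; split => /=; [split => //=; exact: ltW|exact: ltW].
  apply: le_trans (volU_le fX1 fU) _.
  by rewrite lerD2l volU_le.
have hX2 : vol X2 <= 2 * vol (scone d t').
  pose c2 := (1 - 8 * u)^-1.
  have [c20 c2d] := contraction_factor u0 u1 du; rewrite -/c2 in c20 c2d.
  have := vol_head_affine b (@ltr01 R) (fvol_scone d t').
  rewrite invr1 mul1r => <-.
  set Z := [set z | _].
  have fZ : fvol Z.
    split.
      refine (@mset_head R d (scone d t') (fun x _ => 1 * x + b) _ (mset_scone t')).
      apply: mfuncD; last exact: mfunc_cst.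
      by apply: mfuncM; [exact: mfunc_cst|exact: mfunc_coord].
    rewrite volume_head_affine//; last exact: mset_scone.
    by rewrite fin_numM//; case: (fvol_scone d t').
  apply: le_trans (_ : Num.sqrt c2 ^+ d * vol Z <= _); last first.
    by rewrite ler_wpM2r// vol_ge0.
  apply: le_vol_slice1 => //.
  move=> x; have [/andP[xh xt']|nx] := boolP ((t - h <= x) && (x <= t')); last first.
    rewrite (_ : [set w | _] = set0).
      by rewrite volume0 mule_ge0 ?volume_ge0 ?lee_fin ?exprn_ge0// sqrtr_ge0.
    apply/seteqP; split => // w [[_ /=]]; rewrite vcons_head => a1 a2.
    by move: nx; rewrite a1 a2.
  have [x0 xb key] := shift_bound t0 tt' u0 u1 t'E2 t2 xh xt'.
  rewrite -/h -/b in xb key.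
  have xb0 : 0 <= x + b by exact: le_trans xb.
  apply: (@le_trans _ _ (volume (euball d (slice_radius t x)))).
    rewrite -slice_scone//; apply: le_volume.
    - by apply: mset_slice; case: fX2.
    - by apply: mset_slice; exact: mset_scone.
    by move=> w [[]].
  rewrite (_ : [set w | Z (vcons x w)] =
      [set w | scone d t' (vcons (x + b) w)]); last first.
    by apply/seteqP; split => w; rewrite /Z /= vcons_head vtail_cons mul1r.
  rewrite slice_scone//; apply: volume_euball_le; first by rewrite sqrtr_gt0.
  apply: le_trans (slice_radius_le t0 (ltW t1) x0) _.
  have rE : 1 - (x + b) ^+ 2 <= slice_radius t' (x + b).
    rewrite /slice_radius le_min lexx /=.
    rewrite mulrA ler_pdivlMr ?exprn_gt0//.
    have : t' ^+ 2 <= (x + b) ^+ 2 by apply: lerXn2r; rewrite ?nnegrE.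
    by clear; lra.
  rewrite sqr_sqrtr ?(ltW c20)//.
  apply: (@le_trans _ _ (c2 * (1 - (x + b) ^+ 2))); last first.
    by rewrite ler_wpM2l// ltW.
  apply: le_trans (_ : c2 * ((1 - 8 * u) * (1 - t ^+ 2)) <= _).
    by rewrite mulrA /c2 mulVf ?mul1r// -invr_eq0 gt_eqF.
  by rewrite ler_wpM2l// ltW.
(* Thus [X3] has at most 16/17 of the volume of [Y], and with [hY] at most 16 times the volume of
   [X2]. The sum over the three parts is 1 + 2 + 16 * 2 = 35. *)
have k1 := homothety_factor u0 u1 du.
have Y0 := vol_ge0 Y.
have : (1 - u) ^+ d.+1 * (1 + 16^-1) * vol Y <= 1 * vol Y by rewrite ler_wpM2r.
move: ((1 - u) ^+ d.+1) hX3 => k hX3; rewrite -mulrA mulrCA => k2.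
by move: hX1 hX2 hX3 hX hY Y0 k2; clear; lra.
Qed.

Lemma vol_scone_shrink d (t t' : R) : (0 < d)%N -> 0 < t < 1 ->
  0 <= t' -> t' ^+ 2 = t ^+ 2 + (1 - t ^+ 2) / (16 * d%:R) ->
  vol (scone d t) <= 35 * vol (scone d t').
Proof.
move=> d0 t01 t'0 t'E; have [t2|t2] := leP (t ^+ 2) 2^-1.
  exact: vol_scone_shrink_small.
have := vol_scone_shrink_large d0 t01 t'0 t'E (ltW t2).
have := vol_ge0 (scone d t'); lra.
Qed.

End shrink.

(** * Upper bounds for the volume of a cap *)

Section cone_bounds.
Context {R : realType}.

Lemma vol_euball_scale n (r : R) : 0 < r ->
  vol (euball n (r ^+ 2)) = r ^+ n * vol (euball n 1).
Proof.
by move=> r0; rewrite /vol volume_euball_scale// fineM//; have [] := @fvol_euball1 R n.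
Qed.

Lemma fvol_origin n : fvol [set 0 : 'rV[R]_n].
Proof.
suff -> : [set 0 : 'rV[R]_n] = euball n 0 by exact: fvol_euball.
apply/seteqP; split => z; rewrite /euball /=; first by move=> ->; rewrite dotp0l.
by move=> z0; apply/eqP; rewrite -dotp_eq0 eq_le z0 dotp_ge0.
Qed.

(** The origin is invariant under dilation by 2, so its finite volume equals 2^-(n+1) times
    itself. *)
Lemma vol_origin n : vol [set 0 : 'rV[R]_n.+1] = 0.
Proof.
have f0 := fvol_origin n.+1.
have := vol_affine 0 (ltr0Sn R 1) f0.
rewrite (_ : [set z | _] = [set 0]); last first.
  apply/seteqP; split => z /=; rewrite addr0; last by move=> ->; rewrite scaler0.
  by move/eqP; rewrite scaler_eq0 pnatr_eq0 /= => /eqP.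
have : (2^-1 : R) ^+ n.+1 < 1 by rewrite exprn_ilt1//; lra.
move: (2^-1 ^+ n.+1) (vol_ge0 [set 0 : 'rV[R]_n.+1]) => k; nra.
Qed.

Lemma vol_opp n (A : set 'rV[R]_n) : mset A -> vol [set z | A (- z)] = vol A.
Proof. by move=> mA; rewrite /vol volume_opp. Qed.

(** The cone and its opposite share only the apex. Without it they are disjoint subsets of the ball,
    and the apex has volume 0. *)
Lemma vol_scone_half d (t : R) : 0 < t ->
  vol (scone d t) <= vol (euball d.+1 1) / 2.
Proof.
move=> t0; pose A := scone d t `&` [set z | 0 < z 0 0].
have mA : mset A.
  apply: msetI; first exact: mset_scone.
  by apply: mset_lt; [exact: mfunc_cst|exact: mfunc_coord].
have fA : fvol A by apply: fvol_sub (fvol_scone d t) _ => // z [].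
have f0 := fvol_origin d.+1.
have h1 : vol (scone d t) <= vol A.
  rewrite -[leRHS]addr0 -(vol_origin d); apply: le_trans (volU_le fA f0).
  apply: le_vol; [exact: mset_scone|exact: fvolU|].
  move=> z zt; have [z1 z2 z3] := zt; have [zp|zn] := ltP 0 (z 0 0).
    by left; split.
  right => /=; apply/eqP; rewrite -dotp_eq0.
  have z00 : z 0 0 = 0 by apply/eqP; rewrite eq_le zn z2.
  move: z3; rewrite z00 expr0n /= pmulr_rle0 ?exprn_gt0// => zz.
  by rewrite eq_le zz dotp_ge0.
have fN : fvol [set z | A (- z)].
  apply: fvol_sub (fvol_euball1 d.+1) _; first exact: mset_opp.
  by move=> z [[]]; rewrite /euball /= !dotpE opprK.
have h2 : vol A + vol [set z | A (- z)] <= vol (euball d.+1 1).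
  rewrite -volU//; last first.
    apply/seteqP; split => // z /= [[_ /= zp] [_ /=]]; rewrite mxE; lra.
  apply: le_vol; [by case: (fvolU fA fN)|exact: fvol_euball1|].
  move=> z [[[]]|[[]]]; rewrite /euball //=.
  by rewrite !dotpE opprK.
rewrite vol_opp// in h2; lra.
Qed.

(* The cone lies in the ball of center t e_0 and radius q. *)
Lemma vol_scone_le_ball d (t q : R) : 0 < t -> t ^+ 2 <= 2^-1 -> 0 < q ->
  q ^+ 2 = 1 - t ^+ 2 -> vol (scone d t) <= q ^+ d.+1 * vol (euball d.+1 1).
Proof.
move=> t0 t2 q0 qt; rewrite -vol_euball_scale//.
have := vol_translate (- t *: pole d) (mset_euball (n := d.+1) (q ^+ 2)).
move=> <-; apply: le_vol; first exact: mset_scone.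
  have := fvol_affine (- t *: pole d) (@ltr01 R) (fvol_euball d.+1 (q ^+ 2)).
  by congr fvol; apply/seteqP; split => z /=; rewrite scale1r.
move=> z [z1 z2 z3]; rewrite /euball /= !dotpE (dotpC z) !dotp_pole.
have -> : pole d 0 0 = 1 :> R by rewrite mxE.
rewrite qt; set r := dotp z z in z1 z3 *; set x := z 0 0 in z2 z3 *.
have r0 : 0 <= r by exact: dotp_ge0.
pose p := Num.sqrt r; have p0 : 0 <= p by exact: sqrtr_ge0.
have pr : r = p ^+ 2 by rewrite sqr_sqrtr.
have xp : t * p <= x by apply: ler_sqr_nneg => //; rewrite exprMn -pr.
have p1 : p <= 1 by apply: ler_sqr_nneg => //; rewrite -pr expr1n.
have h : t * (t * p) <= t * x by rewrite ler_pM2l.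
have : 0 <= (1 - p) * (p + 1 - 2 * t ^+ 2) by rewrite mulr_ge0//; lra.
rewrite pr; nra.
Qed.

Lemma vol_scone_mono d (t1 t2 : R) : 0 <= t1 -> t1 <= t2 ->
  vol (scone d t2) <= vol (scone d t1).
Proof.
move=> h1 h2; apply: le_vol; [exact: mset_scone|exact: fvol_scone|].
move=> z [z1 z2 z3]; split => //; apply: le_trans z3.
by rewrite ler_wpM2r ?dotp_ge0//; nra.
Qed.

(** The slices are compared with those of the ball of radius sqrt 2: at height x <= 1 the squared
    radius is at most x^2 S^2 / t^2 <= 2 S^2 (2 - x^2). Working with slices gives the power S^d,
    which cancels the th^-d of the packing bound. *)
Lemma vol_scone_small d (t S : R) : (0 < d)%N -> 0 < t < 1 -> 2^-1 <= t ^+ 2 ->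
  0 < S -> S ^+ 2 = 1 - t ^+ 2 ->
  vol (scone d t) <= (4 * S) ^+ d * vol (euball d.+1 1).
Proof.
move=> d0 /andP[t0 t1] t2 S0 SE.
have s20 : 0 < Num.sqrt 2 :> R by rewrite sqrtr_gt0.
have s22 : Num.sqrt 2 ^+ 2 = 2 :> R by rewrite sqr_sqrtr.
have := vol_euball_scale d.+1 s20; rewrite s22 => b2.
have h : vol (scone d t) <= (Num.sqrt 2 * S) ^+ d * vol (euball d.+1 2).
  apply: le_vol_slice1; [exact: fvol_scone|exact: fvol_euball| |].
    by rewrite exprn_ge0// mulr_ge0// ltW.
  move=> x; have [x0|x0] := ltP x 0.
    rewrite scone_neg// volume0 mule_ge0 ?volume_ge0 ?lee_fin ?exprn_ge0//.
    by rewrite mulr_ge0// ltW.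
  have [x1|x1] := ltP 1 x.
    rewrite slice_scone// euball_lt0 ?volume0 ?mule_ge0 ?volume_ge0 ?lee_fin ?exprn_ge0//.
      by rewrite mulr_ge0// ltW.
    by rewrite /slice_radius gt_min; apply/orP; left; nra.
  rewrite slice_scone// slice_euball; apply: volume_euball_le.
    by rewrite mulr_gt0.
  apply: le_trans (_ : x ^+ 2 * ((1 - t ^+ 2) / t ^+ 2) <= _).
    by rewrite /slice_radius ge_min lexx orbT.
  rewrite exprMn s22 mulrA ler_pdivrMr ?exprn_gt0// -SE.
  have : 0 <= S ^+ 2 by exact: sqr_ge0.
  move: (S ^+ 2) (t ^+ 2) t2 => s y y2 s0.
  have x2 : x ^+ 2 <= 1 by nra.
  have : x ^+ 2 * s <= 1 * s by rewrite ler_wpM2r.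
  have : s * 1 <= s * (2 * y) by rewrite ler_wpM2l//; lra.
  have : 0 <= s * y by rewrite mulr_ge0//; lra.
  have : 0 <= (s * y) * (1 - x ^+ 2) by rewrite !mulr_ge0//; lra.
  nra.
apply: le_trans h _; rewrite b2 mulrA ler_wpM2r ?vol_ge0//.
have -> : (Num.sqrt 2 * S) ^+ d * Num.sqrt 2 ^+ d.+1 =
    (2 * S) ^+ d * Num.sqrt 2.
  by rewrite exprSr mulrA -exprMn mulrAC -expr2 s22.
rewrite (_ : 4 * S = 2 * S * 2); last by ring.
rewrite (exprMn d (2 * S)) ler_wpM2l//; first by rewrite exprn_ge0// mulr_ge0// ltW.
have s2 : Num.sqrt 2 <= 2 :> R by apply: ler_sqr_nneg => //; rewrite s22; lra.
apply: le_trans s2 _; rewrite -{1}[2]expr1.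
by rewrite ler_weXn2l// ler1n.
Qed.

End cone_bounds.

(** * Packing, nets of the sphere, and caps as cones *)

Section packing.
Context {R : realType}.

Lemma vol_scone_gt0 d (t : R) : 0 < t < 1 -> 0 < vol (scone d t).
Proof.
(* The ball of radius sqrt (1 - t^2) / 8 around 3/8 of the pole lies in the cone. *)
move=> /andP[t0 t1]; pose r := Num.sqrt ((1 - t ^+ 2) / 64).
have rp : 0 < (1 - t ^+ 2) / 64 by rewrite divr_gt0//; nra.
have r0 : 0 < r by rewrite sqrtr_gt0.
have rE : r ^+ 2 = (1 - t ^+ 2) / 64 by rewrite sqr_sqrtr// ltW.
pose A := [set z : 'rV[R]_d.+1 | euball d.+1 (r ^+ 2) (z + (- (3 / 8)) *: pole d)].
have fA : fvol A.
  have := fvol_affine (- (3 / 8) *: pole d) (@ltr01 R) (fvol_euball d.+1 (r ^+ 2)).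
  by congr fvol; apply/seteqP; split => z /=; rewrite scale1r.
have vA : 0 < vol A.
  rewrite /A (vol_translate _ (mset_euball (n := d.+1) _)) vol_euball_scale//.
  by rewrite mulr_gt0 ?exprn_gt0 ?vol_euball1_gt0.
apply: lt_le_trans vA _; apply: le_vol; [by case: fA|exact: fvol_scone|].
move=> z; rewrite /A /euball /scone /= rE.
rewrite -(vcons_eta z) poleE vconsZ scaler0 vconsD addr0 !dotp_cons vcons_head.
move: (z 0 0) (dotp _ _) (dotp_ge0 (vtail z)) => x w w0 h.
have tt : 0 < t ^+ 2 < 1 by apply/andP; split; [rewrite exprn_gt0|nra].
move: (t ^+ 2) tt h {rp rE t0 t1} => s /andP[s0 s1] h.
have x1 : (x - 3 / 8) ^+ 2 <= (1 / 8) ^+ 2 by nra.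
have x2 : x <= 1 / 2 by nra.
have x3 : 1 / 4 <= x by nra.
have w1 : w <= (1 - s) / 64 by have := sqr_ge0 (x - 3 / 8); nra.
have y1 : 0 <= (1 - s) * w by rewrite mulr_ge0//; lra.
have y2 : 0 <= (1 - s) * (x ^+ 2 - 1 / 16) by rewrite mulr_ge0//; nra.
by split; [nra|lra|nra].
Qed.

(** Points with |z| < 1/2 are discarded because in [cap_margin] the gain (t' - t) |z| has to beat an
    error that does not scale with |z|. *)
Definition shell_cone d (t : R) : set 'rV[R]_d.+1 :=
  scone d t `&` [set z | 4^-1 <= dotp z z].

Lemma mset_shell_cone d t : mset (@shell_cone d t).
Proof.
apply: msetI; first exact: mset_scone.
by apply: mset_le; [exact: mfunc_cst|exact: mfunc_normsq].
Qed.

Lemma fvol_shell_cone d t : fvol (@shell_cone d t).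
Proof.
by apply: fvol_sub (fvol_scone d t) _; [exact: mset_shell_cone|move=> z []].
Qed.

(** The discarded part lies in the cone scaled by 1/2, whose relative volume 2^-(d+1) is at most
    1/4. *)
Lemma vol_shell_cone d (t : R) : (0 < d)%N ->
  3 / 4 * vol (scone d t) <= vol (@shell_cone d t).
Proof.
move=> d0; pose C := scone d t `&` [set z | dotp z z < 4^-1].
have fC : fvol C.
  apply: fvol_sub (fvol_scone d t) _; last by move=> z [].
  apply: msetI; first exact: mset_scone.
  by apply: mset_lt; [exact: mfunc_normsq|exact: mfunc_cst].
have h1 : vol (scone d t) <= vol C + vol (@shell_cone d t).
  apply: le_trans (volU_le fC (fvol_shell_cone d t)).
  apply: le_vol; [exact: mset_scone|exact: fvolU fC (fvol_shell_cone d t)|].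
  by move=> z zt; have [zl|zg] := ltP (dotp z z) 4^-1; [left|right]; split.
have h2 : vol C <= 2^-1 ^+ d.+1 * vol (scone d t).
  have := vol_affine 0 (ltr0Sn R 1) (fvol_scone d t) => <-.
  apply: le_vol; first by case: fC.
    exact: fvol_affine (ltr0Sn R 1) (fvol_scone d t).
  move=> z [[z1 z2 z3] /= z4]; rewrite /= addr0; split; rewrite ?mxE ?dotpE.
  - lra.
  - by rewrite mulr_ge0.
  - by nra.
have h3 : 2^-1 ^+ d.+1 <= 4^-1 :> R.
  have -> : 4^-1 = 2^-1 ^+ 2 :> R by field.
  by apply: ler_wiXn2l; [lra|lra|rewrite ltnS].
have := vol_ge0 (scone d t); move: (vol (scone d t)) h1 h2 => v h1 h2 v0.
have : 2^-1 ^+ d.+1 * v <= 4^-1 * v by rewrite ler_wpM2r.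
lra.
Qed.

Definition sepb n (r : R) (x y : 'rV[R]_n) : bool := r < dotp (x - y) (x - y).

Definition balls n (r : R) (s : seq 'rV[R]_n) : set 'rV[R]_n :=
  [set z | exists2 x, x \in s & dotp (z - x) (z - x) <= r].

Lemma fvol_ballc n (r : R) (x : 'rV[R]_n) :
  fvol [set z | dotp (z - x) (z - x) <= r].
Proof.
have := fvol_affine (- x) (@ltr01 R) (fvol_euball n r).
by congr fvol; apply/seteqP; split => z; rewrite /euball /= scale1r.
Qed.

Lemma vol_ballc n (r : R) (x : 'rV[R]_n) : 0 < r ->
  vol [set z | dotp (z - x) (z - x) <= r ^+ 2] = r ^+ n * vol (euball n 1).
Proof.
move=> r0; rewrite -vol_euball_scale//.
by rewrite -(vol_translate (- x) (mset_euball (n := n) (r ^+ 2))).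
Qed.

Lemma balls_cons n (r : R) x (s : seq 'rV[R]_n) :
  balls r (x :: s) = [set z | dotp (z - x) (z - x) <= r] `|` balls r s.
Proof.
apply/seteqP; split => z.
  by move=> [y]; rewrite inE => /predU1P[->|ys] h; [left|right; exists y].
move=> [h|[y ys h]]; first by exists x => //; rewrite mem_head.
by exists y => //; rewrite inE ys orbT.
Qed.

Lemma fvol_balls n (r : R) (s : seq 'rV[R]_n) : fvol (balls r s).
Proof.
elim: s => [|x s IHs]; last first.
  by rewrite balls_cons; apply: fvolU => //; exact: fvol_ballc.
rewrite (_ : balls r [::] = euball n (-1)); first exact: fvol_euball.
by rewrite euball_lt0//; apply/seteqP; split => // z [].
Qed.

Lemma vol_balls n (r : R) (s : seq 'rV[R]_n) : 0 < r ->
  pairwise (sepb (4 * r ^+ 2)) s ->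
  vol (balls (r ^+ 2) s) = (size s)%:R * (r ^+ n * vol (euball n 1)).
Proof.
move=> r0; elim: s => [_|x s IHs /=].
  by rewrite mul0r -(vol_set0 n); congr vol; apply/seteqP; split => // z [].
move=> /andP[/allP xs ps]; rewrite balls_cons volU.
- by rewrite IHs// vol_ballc// -natr1 mulrDl mul1r addrC.
- exact: fvol_ballc.
- exact: fvol_balls.
apply/seteqP; split => // z [/= zx [y ys zy]].
have := xs y ys; rewrite /sepb.
have := dotp_ge0 ((z - x) + (z - y)).
have -> : x - y = (z - y) - (z - x) by rewrite [RHS]addrC opprB addrA subrK.
move: (z - x) (z - y) zx zy => a b; rewrite !dotpE (dotpC b a); nra.
Qed.

Lemma exprB_le (a b : R) n : 0 <= b -> b <= a ->
  a ^+ n.+1 - b ^+ n.+1 <= n.+1%:R * (a - b) * a ^+ n.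
Proof.
move=> b0 ba; elim: n => [|n IHn]; first by rewrite !expr0 !expr1; lra.
rewrite exprS [b ^+ _]exprS -[n.+2%:R]natr1.
have h : b ^+ n.+1 <= a ^+ n.+1 by apply: lerXn2r; rewrite ?nnegrE//; lra.
have -> : a * a ^+ n.+1 - b * b ^+ n.+1 =
  a * (a ^+ n.+1 - b ^+ n.+1) + (a - b) * b ^+ n.+1 by ring.
have h1 : a * (a ^+ n.+1 - b ^+ n.+1) <= a * (n.+1%:R * (a - b) * a ^+ n).
  by rewrite ler_wpM2l//; lra.
have h2 : (a - b) * b ^+ n.+1 <= (a - b) * a ^+ n.+1 by rewrite ler_wpM2l//; lra.
apply: le_trans (lerD h1 h2) _; rewrite exprS.
by rewrite le_eqVlt; apply/orP; left; apply/eqP; ring.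
Qed.

(* Balls around the points are packed in a shell and not only in a ball; this
   gives the exponent d rather than d + 1, which matters for small caps. *)
Lemma separated_size d (th : R) (s : seq 'rV[R]_d.+1) : 0 < th < 1 ->
  (forall x, x \in s -> dotp x x = 1) -> pairwise (sepb (th ^+ 2)) s ->
  (size s)%:R <= 3 * d.+1%:R * (1 + 2 / th) ^+ d.
Proof.
move=> /andP[th0 th1] s1 ps; pose r := th / 2.
have r0 : 0 < r by rewrite divr_gt0.
have thE : th ^+ 2 = 4 * r ^+ 2 by rewrite /r; field.
rewrite thE in ps; have vE := vol_balls r0 ps.
have b0 := @vol_euball1_gt0 R d.+1; set be := vol _ in b0 vE.
(* A ball of radius r around a unit vector avoids the open ball of radius 1 - r, hence the closed
   ball of radius 1 - th = 1 - 2 r. The thickness 3 r of the shell is the origin of the factor 3. *)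
pose D := euball d.+1 ((1 + r) ^+ 2) `\` euball d.+1 ((1 - th) ^+ 2).
have fD : fvol D.
  apply: fvol_sub (fvol_euball d.+1 ((1 + r) ^+ 2)) _; last exact: subDsetl.
  by apply: msetD; exact: mset_euball.
have hD : vol (balls (r ^+ 2) s) <= vol D.
  apply: le_vol => //; first by case: (fvol_balls (r ^+ 2) s).
  move=> z [x xs]; have x1 := s1 x xs.
  have : z = x + (z - x) by rewrite addrC subrK.
  move: (z - x) => y zE h.
  have := dotp_CS x y; rewrite x1 mul1r => cs.
  have c1 : dotp x y <= r.
    by apply: ler_sqr_nneg (ltW r0) _; apply: le_trans cs _.
  have c2 : - dotp x y <= r.
    by apply: ler_sqr_nneg (ltW r0) _; rewrite sqrrN; apply: le_trans cs _.
  have y0 := dotp_ge0 y; have hy : dotp y y <= r ^+ 2 by [].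
  have zz : dotp z z = 1 + 2 * dotp x y + dotp y y.
    by rewrite zE !dotpE x1 (dotpC y x); ring.
  split; rewrite /euball /= zz; first by nra.
  apply/negP; rewrite -ltNge.
  move: cs c1 c2 y0 hy; move: (dotp x y) (dotp y y) => p q cs c1 c2 q0 qr.
  have t2 : th = 2 * r by rewrite /r; field.
  have : 0 <= (r - p) by lra.
  have : 1 + 2 * p + p ^+ 2 <= 1 + 2 * p + q by lra.
  have : (1 - r) ^+ 2 <= (1 + p) ^+ 2 by nra.
  rewrite t2; nra.
have vD : vol D = ((1 + r) ^+ d.+1 - (1 - th) ^+ d.+1) * be.
  rewrite volD; [|exact: fvol_euball|exact: mset_euball|].
    by rewrite !vol_euball_scale ?mulrBl//; lra.
  by move=> z; rewrite /euball /= => h; apply: le_trans h _; nra.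
move: hD; rewrite vE vD => hD.
have e1 : (1 + r) ^+ d.+1 - (1 - th) ^+ d.+1 <=
    d.+1%:R * (1 + r - (1 - th)) * (1 + r) ^+ d by apply: exprB_le; lra.
have e2 : (size s)%:R * r ^+ d.+1 <= d.+1%:R * (3 * r) * (1 + r) ^+ d.
  move: hD; rewrite mulrA ler_pM2r// => hD; apply: le_trans hD _.
  apply: le_trans e1 _; rewrite le_eqVlt; apply/orP; left; apply/eqP.
  by congr (_ * _ * _); rewrite /r; field.
have -> : 1 + 2 / th = (1 + r) / r by rewrite /r; field; rewrite gt_eqF.
have rd : 0 < r ^+ d.+1 by rewrite exprn_gt0.
rewrite -(ler_pM2r rd); apply: le_trans e2 _.
rewrite le_eqVlt; apply/orP; left; apply/eqP; rewrite expr_div_n exprS.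
by field; rewrite expf_neq0// gt_eqF.
Qed.

(** A separated set of maximal size is a net; the packing bound ensures that a maximal size
    exists. *)
Lemma sphere_net d (th : R) : 0 < th < 1 ->
  exists s : seq 'rV[R]_d.+1,
    [/\ (size s)%:R <= 3 * d.+1%:R * (1 + 2 / th) ^+ d,
        forall x, x \in s -> dotp x x = 1 &
        forall x, dotp x x = 1 ->
          exists2 y, y \in s & dotp (x - y) (x - y) <= th ^+ 2].
Proof.
move=> th01; pose K : R := 3 * d.+1%:R * (1 + 2 / th) ^+ d.
pose P m := `[< exists s : seq 'rV[R]_d.+1, [/\ size s = m,
  forall x, x \in s -> dotp x x = 1 & pairwise (sepb (th ^+ 2)) s] >].
have P0 : exists m, P m by exists 0%N; apply/asboolP; exists [::].
have Pb m : P m -> (m <= Num.truncn K)%N.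
  move=> /asboolP[s [<- s1 s2]].
  have := separated_size th01 s1 s2; rewrite -/K => sK.
  by rewrite truncn_ge_nat// (le_trans _ sK).
case: (ex_maxnP P0 Pb) => m /asboolP[s [sm s1 s2]] mmax.
exists s; split; [exact: separated_size|exact: s1|].
move=> x x1; apply/not_exists2P => nx.
have : P m.+1.
  apply/asboolP; exists (x :: s); split; first by rewrite /= sm.
    by move=> y; rewrite inE => /predU1P[->|/s1].
  rewrite /= s2 andbT; apply/allP => y ys; rewrite /sepb ltNge; apply/negP => h.
  by have [] := nx y.
by move/mmax; rewrite ltnn.
Qed.

Lemma acos_le (x e : R) : -1 <= x <= 1 -> 0 <= e <= pi ->
  (acos x <= e) = (cos e <= x).
Proof.
move=> x1 e1; have xK : cos (acos x) = x by apply: acosK; rewrite in_itv.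
rewrite -[in RHS]xK !leNgt; congr (~~ _); apply/esym.
by rewrite ltr_cos// in_itv //= acos_ge0// acos_lepi.
Qed.

Lemma dotp_sphere_bound n (x y : 'rV[R]_n) : dotp x x = 1 -> dotp y y = 1 ->
  -1 <= dotp x y <= 1.
Proof.
move=> x1 y1; have := dotp_CS x y; rewrite x1 y1 mulr1 => h.
by apply/andP; split; nra.
Qed.

(** The apex is 0 times the pole, and any other z is |z| times z / |z|; as cos eps > 0, the
    condition on the angle may be squared. *)
Lemma cone_cap d (eps : R) : 0 < eps < pi / 2 ->
  cone (cap (pole d) eps) = scone d (cos eps).
Proof.
move=> /andP[e0 e1]; have pi0 := pi_gt0 R.
have c0 : 0 < cos eps by apply: cos_gt0_pihalf; apply/andP; split; lra.
have epi : 0 <= eps <= pi by apply/andP; split; lra.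
have p1 : dotp (pole d) (pole d) = 1 :> R by rewrite dotp_pole mxE.
apply/seteqP; split => z.
  move=> [r [x [/andP[r0 r1] [x1 xe] ->]]].
  have := xe; rewrite /geodist acos_le//; last exact: dotp_sphere_bound.
  rewrite dotp_pole => cx.
  rewrite /scone /= !dotpE mxE; have -> : dotp x x = 1 by [].
  split; [by nra|by rewrite mulr_ge0//; lra|].
  rewrite mulr1 exprMn mulrC -expr2 ler_wpM2l ?sqr_ge0//; nra.
move=> [z1 z2 z3]; have [/eqP|zn0] := eqVneq (dotp z z) 0.
  rewrite dotp_eq0 => /eqP ->; exists 0, (pole d); split; last by rewrite scale0r.
    by rewrite lexx ler01.
  split => //; rewrite /geodist acos_le//; last exact: dotp_sphere_bound.
  by rewrite p1 cos_le1.
have zp : 0 < dotp z z by rewrite lt_neqAle eq_sym zn0 dotp_ge0.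
pose r := Num.sqrt (dotp z z); have r0 : 0 < r by rewrite sqrtr_gt0.
have rE : r ^+ 2 = dotp z z by rewrite sqr_sqrtr// ltW.
have x1 : dotp (r^-1 *: z) (r^-1 *: z) = 1.
  by rewrite !dotpE -rE; field; rewrite gt_eqF.
exists r, (r^-1 *: z); split.
- rewrite ltW//=; apply: ler_sqr_nneg => //; by rewrite rE expr1n.
- split => //; rewrite /geodist acos_le//; last exact: dotp_sphere_bound.
  rewrite dotp_pole mxE mulrC ler_pdivlMr//; apply: ler_sqr_nneg => //.
  by rewrite exprMn rE.
- by rewrite scalerA mulfV ?scale1r// gt_eqF.
Qed.

Lemma capVE d (eps : R) : 0 < eps < pi / 2 ->
  capV d eps = vol (scone d (cos eps)) / vol (euball d.+1 1).
Proof. by move=> he; rewrite /capV /sigma cone_cap. Qed.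

End packing.

Arguments shell_cone {R} d t _ : simpl never.

(** * Choice of the points *)

Section averaging.
Context {R : realType}.
Local Notation T := (measurableTypeR R).

Definition integ n (B : set 'rV[R]_n) (f : 'rV[R]_n -> R) : \bar R :=
  (\int[lebesgue_tuple n]_(t in @vec R n @^-1` B) (f (vec t))%:E)%E.

Lemma measurable_integrand n (B : set 'rV[R]_n) (f : 'rV[R]_n -> R) : mfunc f ->
  measurable_fun (@vec R n @^-1` B) (fun t : n.-tuple T => (f (vec t))%:E).
Proof. by move=> mf; apply/measurable_EFinP; exact: measurable_funTS. Qed.

Lemma mfunc_indic n (A : set 'rV[R]_n) : mset A -> mfunc (\1_A : _ -> R).
Proof.
move=> mA; rewrite /mfunc.
rewrite (_ : _ \o _ = (\1_(@vec R n @^-1` A) : _ -> R)); last exact/funext.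
exact: measurable_indic.
Qed.

Lemma integD n (B : set 'rV[R]_n) (f g : 'rV[R]_n -> R) :
  mset B -> mfunc f -> mfunc g -> (forall z, 0 <= f z) -> (forall z, 0 <= g z) ->
  integ B (fun z => f z + g z) = (integ B f + integ B g)%E.
Proof.
move=> mB mf mg f0 g0; rewrite /integ -ge0_integralD//.
- by move=> t _; rewrite lee_fin.
- exact: measurable_integrand.
- by move=> t _; rewrite lee_fin.
- exact: measurable_integrand.
Qed.

Lemma integZ n (B : set 'rV[R]_n) (c : R) (f : 'rV[R]_n -> R) :
  mset B -> mfunc f -> (forall z, 0 <= f z) -> 0 <= c ->
  integ B (fun z => c * f z) = (c%:E * integ B f)%E.
Proof.
move=> mB mf f0 c0; rewrite /integ -ge0_integralZl//.
- exact: measurable_integrand.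
- by move=> t _; rewrite lee_fin.
Qed.

Lemma mfunc_sum_seq n (I : Type) (s : seq I) (f : I -> 'rV[R]_n -> R) :
  (forall i, mfunc (f i)) -> mfunc (fun z => \sum_(i <- s) f i z).
Proof.
move=> mf; elim: s => [|i s IHs].
  by apply: eq_mfunc (mfunc_cst 0) => z; rewrite big_nil.
by apply: eq_mfunc (mfuncD (mf i) IHs) => z; rewrite big_cons.
Qed.

Lemma integ_sum n (I : Type) (s : seq I) (B : set 'rV[R]_n)
    (f : I -> 'rV[R]_n -> R) :
  mset B -> (forall i, mfunc (f i)) -> (forall i z, 0 <= f i z) ->
  integ B (fun z => \sum_(i <- s) f i z) = (\sum_(i <- s) integ B (f i))%E.
Proof.
move=> mB mf f0; elim: s => [|i s IHs].
  rewrite big_nil /integ integral0_eq// => t _; by rewrite big_nil.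
rewrite big_cons -IHs -integD//; last 2 first.
- exact: mfunc_sum_seq.
- by move=> z; rewrite sumr_ge0.
by apply: eq_integral => t _; rewrite big_cons.
Qed.

Lemma integ_indic n (B E : set 'rV[R]_n) : mset B -> mset E ->
  integ B (\1_E) = volume (E `&` B).
Proof. by move=> mB mE; rewrite /integ integral_indic. Qed.

(** If every z in B failed, integration over B would give a S <= a0 S for S the sum of the w i. The
    strict gap a0 < a excludes this when S > 0; when S = 0 all the w i vanish and any point of B
    will do. *)
Lemma averaging n (B : set 'rV[R]_n) (I : eqType) (s : seq I) (w : I -> R)
    (W : I -> 'rV[R]_n -> R) (a0 a : R) :
  fvol B -> 0 < vol B -> (forall i, 0 <= w i) -> (forall i, mfunc (W i)) ->
  (forall i z, 0 <= W i z) -> 0 <= a0 < a ->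
  (forall i, i \in s -> (integ B (W i) <= (a0 * vol B)%:E)%E) ->
  exists2 z, B z & \sum_(i <- s) w i * W i z <= a * \sum_(i <- s) w i.
Proof.
move=> fB B0 w0 mW W0 /andP[a00 a0a] hW; have [mB _] := fB.
pose S := \sum_(i <- s) w i; have S0 : 0 <= S by rewrite sumr_ge0.
apply: contrapT => nz.
have lt_z z : B z -> a * S <= \sum_(i <- s) w i * W i z.
  by move=> Bz; rewrite leNgt; apply/negP => h; apply: nz; exists z => //; exact: ltW.
have Sp : 0 < S.
  rewrite lt_neqAle S0 andbT; apply/eqP => /esym Sz; apply: nz.
  have [z Bz] : exists z, B z.
    apply: contrapT => /forallNP nB; move: B0.
    by rewrite (_ : B = set0) ?vol_set0 ?ltxx//; apply/seteqP; split.
  exists z => //; rewrite -/S Sz mulr0.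
  move: Sz => /eqP; rewrite psumr_eq0// => /allP w00.
  rewrite big_seq big1// => i /w00 /eqP ->; exact: mul0r.
have mf i : mfunc (fun z => w i * W i z).
  by apply: mfuncM => //; exact: mfunc_cst.
have f0 i z : 0 <= w i * W i z by rewrite mulr_ge0.
have h1 : ((a * S * vol B)%:E <=
    integ B (fun z => (\sum_(i <- s) w i * W i z)%R))%E.
  have -> : (a * S * vol B)%:E =
      (\int[lebesgue_tuple n]_(t in @vec R n @^-1` B) (a * S)%:E)%E.
    by rewrite integral_cst// EFinM -(fvolE fB).
  apply: ge0_le_integral => //.
  - by move=> t _; rewrite lee_fin mulr_ge0//; lra.
  - have hm := measurable_integrand (B:=B) (mfunc_sum_seq s mf). exact: hm.
  - by move=> t Bt; rewrite lee_fin; exact: lt_z.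
have h2 : (integ B (fun z => (\sum_(i <- s) w i * W i z)%R) <=
    (a0 * S * vol B)%:E)%E.
  rewrite integ_sum// /S mulr_sumr mulr_suml -sumEFin.
  rewrite big_seq [leRHS]big_seq; apply: lee_sum => i si.
  rewrite integZ// (_ : a0 * w i * vol B = w i * (a0 * vol B)); last by ring.
  by rewrite EFinM lee_wpmul2l ?lee_fin//; exact: hW.
have := le_trans h1 h2; rewrite lee_fin ler_pM2r// ler_pM2r//; lra.
Qed.

(* Method of conditional expectations: the points are chosen one at a time, and
   each choice decreases the sum of the weights by the factor [a]. *)
Lemma greedy_choice n (B : set 'rV[R]_n) (I : eqType) (s : seq I)
    (W : I -> 'rV[R]_n -> R) (a0 a : R) (N : nat) :
  fvol B -> 0 < vol B -> (forall i, mfunc (W i)) ->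
  (forall i z, 0 <= W i z) -> 0 <= a0 < a ->
  (forall i, i \in s -> (integ B (W i) <= (a0 * vol B)%:E)%E) ->
  exists zs : seq 'rV[R]_n, [/\ size zs = N, forall z, z \in zs -> B z &
    \sum_(i <- s) \prod_(z <- zs) W i z <= a ^+ N * (size s)%:R].
Proof.
move=> fB B0 mW W0 a0a hW; elim: N => [|N [zs [zN zB zle]]].
  exists [::]; split => //; under eq_bigr do rewrite big_nil.
  by rewrite big_const_seq count_predT iter_addr_0 expr0 mul1r.
pose w i := \prod_(z <- zs) W i z.
have w0 i : 0 <= w i by rewrite prodr_ge0.
have [z Bz hz] := averaging fB B0 w0 mW W0 a0a hW.
exists (z :: zs); split; first by rewrite /= zN.
  by move=> y; rewrite inE => /predU1P[->|/zB].
under eq_bigr do rewrite big_cons mulrC.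
apply: le_trans hz _; rewrite exprS -mulrA ler_wpM2l//.
by case/andP: a0a => ? ?; lra.
Qed.

End averaging.

(** * Subgaussian tails on a cap *)

Section weights.
Context {R : realType}.

Lemma expRN_le_half : expR (-1) <= 2^-1 :> R.
Proof.
by rewrite expRN lef_pV2 ?posrE ?expR_gt0//; have := expR_ge1Dx (1 : R); lra.
Qed.

(** q^d = (1 - k / d)^(d / 2) <= exp (- k / 2), and exp (-1) <= 1/2 <= (3/4)^2. *)
Lemma tail_factor (d k : nat) (q : R) : (0 < k < d)%N -> 0 < q ->
  q ^+ 2 = 1 - k%:R / d%:R -> q ^+ d <= (3 / 4) ^+ k.
Proof.
move=> /andP[k0 kd] q0 qE.
have d0 : 0 < d%:R :> R by rewrite ltr0n (leq_trans _ kd).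
have h1 : q ^+ 2 <= expR (- (k%:R / d%:R)).
  by rewrite qE; have := expR_ge1Dx (- (k%:R / d%:R) : R); lra.
have h2 : (q ^+ 2) ^+ d <= (expR (- (k%:R / d%:R))) ^+ d.
  by apply: lerXn2r; rewrite ?nnegrE ?sqr_ge0 ?expR_ge0.
have h3 : (expR (- (k%:R / d%:R))) ^+ d = expR (-1 : R) ^+ k.
  rewrite -!expRM_natl; congr expR; field; exact: lt0r_neq0.
have h4 : expR (-1 : R) ^+ k <= ((3 / 4) ^+ 2) ^+ k.
  apply: lerXn2r; rewrite ?nnegrE ?expR_ge0 ?sqr_ge0//.
  by have := expRN_le_half; lra.
apply: ler_sqr_nneg; first by rewrite exprn_ge0.
rewrite -!exprM [(d * 2)%N]mulnC [(k * 2)%N]mulnC !exprM.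
by apply: le_trans h2 _; rewrite h3.
Qed.

(** With s^2 = k / d the condition reads |<v, z>| >= s S, which is the union of two halfspaces, for
    v and for - v; hence the factor 2. *)
Lemma shell_tail d (t : R) (v : 'rV[R]_d) k : dotp v v <= 1 -> 0 < t < 1 ->
  (0 < k < d)%N ->
  vol (shell_cone d t `&`
       [set z | k%:R * (1 - t ^+ 2) <= d%:R * dotp v (vtail z) ^+ 2])
  <= 2 * (3 / 4) ^+ k * vol (scone d t).
Proof.
move=> v1 /andP[t0 t1] kd; have /andP[k0 kd'] := kd.
have d0 : 0 < d%:R :> R by rewrite ltr0n (leq_trans _ kd').
have kd1 : k%:R / d%:R < 1 :> R by rewrite ltr_pdivrMr// mul1r ltr_nat.
have kd0 : 0 <= k%:R / d%:R :> R by rewrite divr_ge0.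
pose s := Num.sqrt (k%:R / d%:R) : R; pose q := Num.sqrt (1 - k%:R / d%:R) : R.
have sE : s ^+ 2 = k%:R / d%:R by rewrite sqr_sqrtr.
have qE : q ^+ 2 = 1 - k%:R / d%:R by rewrite sqr_sqrtr//; lra.
have q0 : 0 < q by rewrite sqrtr_gt0; lra.
have s0 : 0 <= s by exact: sqrtr_ge0.
have t01 : 0 < t <= 1 by rewrite t0 ltW.
have qs : q ^+ 2 = 1 - s ^+ 2 by rewrite sE.
have Nv1 : dotp (- v) (- v) <= 1 by rewrite !dotpE opprK.
pose S := Num.sqrt (1 - t ^+ 2).
have S0 : 0 <= S by exact: sqrtr_ge0.
have SE : S ^+ 2 = 1 - t ^+ 2 by rewrite sqr_sqrtr//; nra.
have h1 := vol_scone_halfspace v1 t01 s0 q0 qs.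
have h2 := vol_scone_halfspace Nv1 t01 s0 q0 qs.
have fH (u : 'rV[R]_d) :
    fvol (scone d t `&` [set z | s * S <= dotp u (vtail z)]).
  apply: fvol_sub (fvol_scone d t) _; last exact: subIsetl.
  apply: msetI; first exact: mset_scone.
  apply: mset_le; first exact: mfunc_cst.
  by apply: mfunc_dotp => i; [exact: mfunc_cst|exact: mfunc_vtail].
have qk : q ^+ d <= (3 / 4) ^+ k by exact: tail_factor.
have hh : q ^+ d * vol (scone d t) <= (3 / 4) ^+ k * vol (scone d t).
  by rewrite ler_wpM2r// vol_ge0.
apply: le_trans (_ : q ^+ d * vol (scone d t) + q ^+ d * vol (scone d t) <= _).
  apply: le_trans (lerD h1 h2); apply: le_trans (volU_le (fH v) (fH (- v))).
  apply: le_vol; [|exact: fvolU (fH v) (fH (- v))|].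
    apply: msetI; first exact: mset_shell_cone.
    apply: mset_le; first exact: mfunc_cst.
    apply: mfuncM; first exact: mfunc_cst.
    apply: mfuncX.
    by apply: mfunc_dotp => i; [exact: mfunc_cst|exact: mfunc_vtail].
  move=> z [[zt _] /= zk].
  have zz : (s * S) ^+ 2 <= dotp v (vtail z) ^+ 2.
    by rewrite exprMn sE SE mulrAC ler_pdivrMr// mulrC (mulrC _ d%:R) mulrC.
  have [vz|vz] := leP 0 (dotp v (vtail z)).
    by left; split => //=; apply: ler_sqr_nneg.
  right; split => //=; rewrite dotpNl.
  by apply: ler_sqr_nneg; [rewrite oppr_ge0 ltW|rewrite sqrrN].
by lra.
Qed.

(** This is the copy of [shell_cone] with axis x. *)
Definition capcone d (x : 'rV[R]_d.+1) (t : R) : set 'rV[R]_d.+1 :=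
  [set z | [/\ dotp z z <= 1, 0 <= dotp x z, t ^+ 2 * dotp z z <= dotp x z ^+ 2
            & 4^-1 <= dotp z z]].

Lemma mset_capcone d (x : 'rV[R]_d.+1) t : mset (capcone x t).
Proof.
have mx : mfunc (fun z => dotp x z).
  by apply: mfunc_dotp => i; [exact: mfunc_cst|exact: mfunc_coord].
rewrite (_ : capcone x t = [set z | dotp z z <= 1] `&` [set z | 0 <= dotp x z] `&`
  [set z | t ^+ 2 * dotp z z <= dotp x z ^+ 2] `&` [set z | 4^-1 <= dotp z z]).
  apply: msetI; first apply: msetI; first apply: msetI.
  - exact: mset_euball.
  - by apply: mset_le; [exact: mfunc_cst|].
  - apply: mset_le; last exact: mfuncX.
    by apply: mfuncM; [exact: mfunc_cst|exact: mfunc_normsq].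
  - by apply: mset_le; [exact: mfunc_cst|exact: mfunc_normsq].
by apply/seteqP; split => z /=; [case|case; case; case].
Qed.

Lemma fvol_capcone d (x : 'rV[R]_d.+1) t : fvol (capcone x t).
Proof.
by apply: fvol_sub (fvol_euball _ 1) _; [exact: mset_capcone|move=> z []].
Qed.

Definition perp n (x v : 'rV[R]_n) : 'rV[R]_n := v - dotp v x *: x.

Lemma perp_orth n (x v : 'rV[R]_n) : dotp x x = 1 -> dotp (perp x v) x = 0.
Proof. by move=> x1; rewrite /perp !dotpE x1 mulr1 subrr. Qed.

Lemma perp_norm n (x v : 'rV[R]_n) : dotp x x = 1 ->
  dotp (perp x v) (perp x v) = dotp v v - dotp v x ^+ 2.
Proof. by move=> x1; rewrite /perp !dotpE x1 (dotpC x v); ring. Qed.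

Lemma isometry_dotp n (f : 'rV[R]_n -> 'rV[R]_n) :
  (forall a z z', f (a *: z + z') = a *: f z + f z') ->
  (forall z, dotp (f z) (f z) = dotp z z) ->
  forall z z', dotp (f z) (f z') = dotp z z'.
Proof.
move=> fl fi z z'; have := fi (1 *: z + z'); rewrite fl !scale1r !dotpE !fi.
by rewrite (dotpC (f z') _) (dotpC z' z); lra.
Qed.

Lemma vol_capcone d (x : 'rV[R]_d.+1) t : dotp x x = 1 ->
  vol (capcone x t) = vol (shell_cone d t).
Proof.
move=> x1; have [f [fl fi fx fv]] := rotation_to x1.
have fd := isometry_dotp fl fi.
have [_ h] := fv _ (mset_capcone x t).
rewrite /vol -h; congr (fine (volume _)).
apply/seteqP; split => z; rewrite /shell_cone /scone /capcone /= -fx !fd dotp_pole.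
  by case.
by case; case.
Qed.

(** Under a rotation that takes the pole to x, the functional of [perp x v] pulls back to that of a
    vector u orthogonal to the pole, so that only the tail of u matters and [shell_tail] applies. *)
Lemma capcone_tail d (x v : 'rV[R]_d.+1) (t : R) k : dotp x x = 1 ->
  dotp v v <= 1 -> 0 < t < 1 -> (0 < k < d)%N ->
  vol (capcone x t `&`
       [set z | k%:R * (1 - t ^+ 2) <= d%:R * dotp (perp x v) z ^+ 2])
  <= 2 * (3 / 4) ^+ k * vol (scone d t).
Proof.
move=> x1 v1 t01 kd; have [f [fl fi fx fv]] := rotation_to x1.
have fd := isometry_dotp fl fi.
have [u [uE u1]] := isometry_adjoint (perp x v) fl fi.
have u0 : u 0 0 = 0 by rewrite -dotp_pole dotpC -uE fx perp_orth.
have uz z : dotp u z = dotp (vtail u) (vtail z).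
  by rewrite -[in LHS](vcons_eta u) -[in LHS](vcons_eta z) dotp_cons u0 mul0r add0r.
have u2 : dotp (vtail u) (vtail u) <= 1.
  rewrite -uz; apply: le_trans u1 _; rewrite perp_norm//.
  by have := sqr_ge0 (dotp v x); lra.
apply: le_trans (shell_tail u2 t01 kd).
set A := _ `&` _; have mA : mset A.
  apply: msetI; first exact: mset_capcone.
  apply: mset_le; first exact: mfunc_cst.
  apply: mfuncM; first exact: mfunc_cst.
  by apply: mfuncX; apply: mfunc_dotp => i; [exact: mfunc_cst|exact: mfunc_coord].
have [_ h] := fv _ mA.
rewrite le_eqVlt; apply/orP; left; apply/eqP.
rewrite /vol -h; congr (fine (volume _)).
apply/seteqP; split => z; rewrite /A /shell_cone /scone /capcone /=;
  rewrite -{1 2}fx !fd dotp_pole uE uz.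
  by case; case.
by case; case; case.
Qed.

End weights.

(** * The weight of a sample point and its mean *)

Section weight_function.
Context {R : realType}.

Definition tailset d (x v : 'rV[R]_d.+1) (t : R) (k : nat) : set 'rV[R]_d.+1 :=
  capcone x t `&`
  [set z | k%:R * (1 - t ^+ 2) <= d%:R * dotp (perp x v) z ^+ 2].

(* Layer-cake form of a function that dominates exp(y / 5), up to a constant, when
   [P k] is the condition [k <= y]; its mean only involves volumes of tails. *)
Definition stair (m : nat) (P : nat -> bool) : R :=
  1 + \sum_(j < m) (5 / 4) ^+ j / 4 * (P j.+1)%:R.

(* The weight of a sample point z for a center p.1 and a direction p.2: neutral
   outside of the cap, it is small on average on the cap, and large only when
   z has a large component along p.2. *)
Definition weight d (t : R) (p : 'rV[R]_d.+1 * 'rV[R]_d.+1) (z : 'rV[R]_d.+1) : R :=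
  \1_(~` capcone p.1 t) z +
  32^-1 * (\1_(capcone p.1 t) z +
    \sum_(j <- index_enum 'I_d.-1) (5 / 4) ^+ j / 4 * \1_(tailset p.1 p.2 t j.+1) z).

Lemma mset_tailset d (x v : 'rV[R]_d.+1) t k : mset (tailset x v t k).
Proof.
apply: msetI; first exact: mset_capcone.
apply: mset_le; first exact: mfunc_cst.
apply: mfuncM; first exact: mfunc_cst.
by apply: mfuncX; apply: mfunc_dotp => i; [exact: mfunc_cst|exact: mfunc_coord].
Qed.

Lemma indic_ge0 (T : Type) (A : set T) (z : T) : 0 <= \1_A z :> R.
Proof. by rewrite indicE. Qed.

Lemma coef_ge0 (j : nat) : 0 <= (5 / 4) ^+ j / 4 :> R.
Proof. by rewrite divr_ge0// exprn_ge0// divr_ge0. Qed.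

Lemma weight_tail_ge0 d (x v : 'rV[R]_d.+1) t z :
  0 <= \sum_(j <- index_enum 'I_d.-1) (5 / 4) ^+ j / 4 * \1_(tailset x v t j.+1) z :> R.
Proof. by apply: sumr_ge0 => j _; rewrite mulr_ge0 ?coef_ge0 ?indic_ge0. Qed.

Lemma weight_ge0 d (t : R) (p : 'rV[R]_d.+1 * 'rV[R]_d.+1) z : 0 <= weight t p z.
Proof.
rewrite addr_ge0 ?indic_ge0// mulr_ge0 ?invr_ge0//.
by rewrite addr_ge0 ?indic_ge0// weight_tail_ge0.
Qed.

Lemma msetC n (A : set 'rV[R]_n) : mset A -> mset (~` A).
Proof. exact: measurableC. Qed.

Lemma mfunc_weight_tail d (x v : 'rV[R]_d.+1) t :
  mfunc (fun z => \sum_(j <- index_enum 'I_d.-1)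
    (5 / 4) ^+ j / 4 * (\1_(tailset x v t j.+1) z : R)).
Proof.
apply: mfunc_sum_seq => j; apply: mfuncM; first exact: mfunc_cst.
by apply: mfunc_indic; exact: mset_tailset.
Qed.

Lemma mfunc_weight d (t : R) (p : 'rV[R]_d.+1 * 'rV[R]_d.+1) : mfunc (weight t p).
Proof.
apply: mfuncD; first by apply: mfunc_indic; apply: msetC; exact: mset_capcone.
apply: mfuncM; first exact: mfunc_cst.
apply: mfuncD; first by apply: mfunc_indic; exact: mset_capcone.
exact: mfunc_weight_tail.
Qed.

Lemma geom_sum_le (r : R) m : 0 <= r < 1 -> \sum_(j < m) r ^+ j <= (1 - r)^-1.
Proof.
move=> /andP[r0 r1]; have r2 : 0 < 1 - r by lra.
rewrite -(ler_pM2l r2) mulfV ?gt_eqF//.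
have := subrX1 r m; set s := \sum_(_ < _) _ => E.
have : 0 <= r ^+ m by exact: exprn_ge0.
lra.
Qed.

(** On the cap, the coefficients (5/4)^j / 4 meet tails 2 (3/4)^(j+1), with a factor 4/3 for passing
    from [scone] to [shell_cone]. This is the series of (15/16)^j / 2, at most 8, so the weight has
    mean at most (1 + 8) / 32 on the cap, and 1 - 9/32 = 23/32. *)
Lemma integ_weight d (t : R) (x v : 'rV[R]_d.+1) : (0 < d)%N -> 0 < t < 1 ->
  dotp x x = 1 -> dotp v v <= 1 ->
  (integ (euball d.+1 1) (weight t (x, v)) <=
   (vol (euball d.+1 1) - 23 / 32 * vol (shell_cone d t))%:E)%E.
Proof.
move=> d0 t01 x1 v1; pose B := euball d.+1 1 : set 'rV[R]_d.+1.
have mB : mset B by exact: mset_euball.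
have fA := fvol_capcone x t; have [mA _] := fA.
have AB : capcone x t `<=` B by move=> z [].
pose tl z : R := \sum_(j <- index_enum 'I_d.-1)
  (5 / 4) ^+ j / 4 * \1_(tailset x v t j.+1) z.
have mtl : mfunc tl by exact: mfunc_weight_tail.
have tl0 z : 0 <= tl z by exact: weight_tail_ge0.
have mi (E : set 'rV[R]_d.+1) : mset E -> mfunc (\1_E : _ -> R).
  exact: mfunc_indic.
have i0 (E : set 'rV[R]_d.+1) z : 0 <= \1_E z :> R by exact: indic_ge0.
have fT k : fvol (tailset x v t k).
  apply: fvol_sub fA _; last exact: subIsetl.
  exact: mset_tailset.
have E1 : integ B tl = (\sum_(j <- index_enum 'I_d.-1)
    (5 / 4) ^+ j / 4 * vol (tailset x v t j.+1))%:E.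
  have m1 (j : 'I_d.-1) :
      mfunc (fun z => (5 / 4) ^+ j / 4 * (\1_(tailset x v t j.+1) z : R)).
    by apply: mfuncM; [exact: mfunc_cst|exact: mi _ (mset_tailset _ _ _ _)].
  have m0 (j : 'I_d.-1) z : 0 <= (5 / 4) ^+ j / 4 * (\1_(tailset x v t j.+1) z : R).
    by rewrite mulr_ge0 ?coef_ge0.
  rewrite (integ_sum _ mB m1 m0) -sumEFin; apply: eq_bigr => j _.
  rewrite (integZ mB (mi _ (mset_tailset _ _ _ _)) (i0 _) (coef_ge0 j)).
  rewrite integ_indic//; last exact: mset_tailset.
  rewrite [RHS]EFinM -(fvolE (fT _)); congr (_ * volume _)%E.
  by apply/setIidl => z [/AB].
have E2 : integ B (fun z => \1_(capcone x t) z + tl z) =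
    (vol (capcone x t) + \sum_(j <- index_enum 'I_d.-1)
    (5 / 4) ^+ j / 4 * vol (tailset x v t j.+1))%:E.
  rewrite (integD mB (mi _ mA) mtl (i0 _) tl0).
  rewrite E1 EFinD integ_indic// -(fvolE fA); congr (volume _ + _)%E.
  exact/setIidl.
have E3 : integ B (weight t (x, v)) =
  (vol B - vol (capcone x t) + 32^-1 * (vol (capcone x t) +
    \sum_(j <- index_enum 'I_d.-1) (5 / 4) ^+ j / 4 * vol (tailset x v t j.+1)))%:E.
  have mg : mfunc (fun z => \1_(capcone x t) z + tl z).
    exact: mfuncD (mi _ mA) mtl.
  have g0 z : 0 <= \1_(capcone x t) z + tl z by rewrite addr_ge0.
  have c0 : 0 <= 32^-1 :> R by rewrite invr_ge0.
  have h0 z : 0 <= 32^-1 * (\1_(capcone x t) z + tl z) by rewrite mulr_ge0.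
  rewrite /weight (integD mB (mi _ (msetC mA)) (mfuncM (mfunc_cst _) mg) (i0 _) h0).
  rewrite (integZ mB mg g0 c0).
  rewrite E2 -EFinM EFinD; congr (_ + _)%E.
  rewrite integ_indic//; last exact: msetC.
  have fB : fvol B by exact: fvol_euball.
  rewrite -volD// -fvolE; first by congr volume; rewrite setIC.
  by apply: fvol_sub fB _; [exact: msetD|exact: subDsetl].
rewrite E3 lee_fin vol_capcone//.
have hs : vol (scone d t) <= 4 / 3 * vol (shell_cone d t).
  by have := vol_shell_cone t d0; lra.
set a := vol (shell_cone d t) in hs *.
have a0 : 0 <= a by exact: vol_ge0.
suff : \sum_(j <- index_enum 'I_d.-1) (5 / 4) ^+ j / 4 * vol (tailset x v t j.+1)
    <= 8 * a by lra.
have gs := @geom_sum_le (15 / 16) d.-1.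
have {}gs : \sum_(j < d.-1) (15 / 16) ^+ j <= 16 :> R.
  by apply: le_trans (gs _) _; [apply/andP; split; lra|rewrite invf_ple ?posrE; lra].
apply: le_trans (_ : \sum_(j < d.-1) (15 / 16) ^+ j * (a / 2) <= _); last first.
  rewrite -mulr_suml; apply: le_trans (_ : 16 * (a / 2) <= _); last lra.
  by rewrite ler_wpM2r//; lra.
apply: ler_sum => j _.
have kd : (0 < j.+1 < d)%N by rewrite /= -ltn_predRL.
have := capcone_tail x1 v1 t01 kd; rewrite -/(tailset _ _ _ _) => ht.
apply: le_trans (ler_wpM2l (coef_ge0 j) ht) _.
have -> : (15 / 16 : R) ^+ j = (5 / 4) ^+ j * (3 / 4) ^+ j.
  by rewrite -exprMn; congr (_ ^+ _); field.
have p0 : 0 <= (5 / 4 : R) ^+ j * (3 / 4) ^+ j by rewrite mulr_ge0// exprn_ge0.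
rewrite exprS; move: p0; set b := (5 / 4) ^+ j; set c := (3 / 4) ^+ j => p0.
have := ler_wpM2l p0 hs; lra.
Qed.

Lemma stairS m (P : nat -> bool) :
  stair m.+1 P = stair m P + (5 / 4) ^+ m / 4 * (P m.+1)%:R.
Proof. by rewrite /stair big_ord_recr /= addrA. Qed.

(** The coefficients are such that a full stair telescopes to (5/4)^m, and exp (1/5) <= 5/4. The
    range y <= m + 1 goes one beyond the number of steps: tails are only bounded for k < d, and m =
    d - 1 steps still reach the largest value y = d. *)
Lemma stair_ge (m : nat) (y : R) : y <= m%:R + 1 ->
  expR ((y - 1) / 5) <= stair m (fun k => k%:R <= y).
Proof.
have e5 : expR 5^-1 <= 5 / 4 :> R.
  have h := expR_ge1Dx (- 5^-1 : R).
  have e0 : 0 < expR (5^-1 : R) by exact: expR_gt0.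
  rewrite expRN in h; have : expR (5^-1) * (1 - 5^-1) <= 1 :> R.
    by rewrite -[leRHS](mulfV (lt0r_neq0 e0)) ler_pM2l.
  lra.
elim: m => [|m IHm] ym.
  move: ym; rewrite add0r /stair big_ord0 addr0 => ym.
  by rewrite -[leRHS]expR0 ler_expR; lra.
rewrite stairS /=.
have [my|my] := leP m.+1%:R y.
  have full : stair m (fun k => k%:R <= y) = (5 / 4) ^+ m.
    rewrite /stair; transitivity (1 + \sum_(j < m) (5 / 4) ^+ j / 4 : R).
      congr (1 + _); apply: eq_bigr => j _.
      rewrite (le_trans _ my) ?mulr1// ler_nat; exact: ltnW (ltn_ord j).
    rewrite -mulr_suml; have := subrX1 (5 / 4 : R) m.
    set s := \sum_(_ < _) _; lra.
  rewrite full mulr1; apply: le_trans (_ : (5 / 4) ^+ m.+1 <= _); last first.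
    by rewrite exprS; lra.
  apply: le_trans (_ : expR (5^-1) ^+ m.+1 <= _); last first.
    by apply: lerXn2r; rewrite ?nnegrE ?expR_ge0//; lra.
  rewrite -expRM_natl ler_expR.
  by move: ym; rewrite -natr1; lra.
rewrite mulr0 addr0; apply: IHm.
by move: my; rewrite -natr1; lra.
Qed.

Lemma weight_out d (t : R) (x v z : 'rV[R]_d.+1) : ~ capcone x t z ->
  weight t (x, v) z = 1.
Proof.
move=> nz; rewrite /weight /= !indicE in_setC memNset//= add0r.
rewrite big1 ?mulr0 ?addr0// => j _.
by rewrite indicE memNset ?mulr0// => -[].
Qed.

(** The exponent 26/5 = 5 + 1/5 combines 1/32 = 2^-5 >= exp (-5) with the shift by 1 in
    [stair_ge]. *)
Lemma weight_in d (t : R) (x v z : 'rV[R]_d.+1) : (0 < d)%N -> 0 < t < 1 ->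
  dotp x x = 1 -> dotp v v <= 1 -> capcone x t z ->
  expR (d%:R * dotp (perp x v) z ^+ 2 / (1 - t ^+ 2) / 5 - 26 / 5)
  <= weight t (x, v) z.
Proof.
move=> d0 /andP[t0 t1] x1 v1 Az; have [z1 z2 z3 z4] := Az.
have S0 : 0 < 1 - t ^+ 2 by nra.
have dR : 0 < d%:R :> R by rewrite ltr0n.
pose y := d%:R * dotp (perp x v) z ^+ 2 / (1 - t ^+ 2).
have -> : weight t (x, v) z = 32^-1 * stair d.-1 (fun k => k%:R <= y).
  rewrite /weight /= !indicE in_setC (mem_set Az) /= add0r /stair; congr (_ * (_ + _)); apply: eq_bigr => j _.
  congr (_ * _); rewrite indicE; congr (nat_of_bool _)%:R.
  rewrite /y ler_pdivlMr//; apply/idP/idP => [|h]; first by rewrite inE => -[].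
  by rewrite inE; split.
have pz : dotp (perp x v) z = dotp v (perp x z).
  by rewrite /perp !dotpE (dotpC z x) (dotpC v x); ring.
(* On the cap |z|^2 - <x, z>^2 <= (1 - t^2) |z|^2, which bounds the square of every component
   orthogonal to x and gives y <= d. *)
have g2 : dotp (perp x v) z ^+ 2 <= 1 - t ^+ 2.
  rewrite pz; apply: le_trans (dotp_CS _ _) _; rewrite perp_norm// (dotpC z x).
  have h : 0 <= dotp z z - dotp x z ^+ 2.
    by rewrite -(dotpC z x) -perp_norm// dotp_ge0.
  have h' : dotp z z - dotp x z ^+ 2 <= 1 - t ^+ 2 by nra.
  have := ler_wpM2r h v1; lra.
have yd : y <= d.-1%:R + 1.
  by rewrite natr1 prednK// /y ler_pdivrMr// ler_pM2l.
have e5 : expR (-5) <= 32^-1 :> R.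
  have -> : expR (-5) = expR (-1) ^+ 5 :> R by rewrite -expRM_natl; congr expR; ring.
  have -> : 32^-1 = 2^-1 ^+ 5 :> R by field.
  apply: lerXn2r; rewrite ?nnegrE ?expR_ge0//.
  exact: expRN_le_half.
rewrite -/y (_ : y / 5 - 26 / 5 = -5 + (y - 1) / 5); last by field.
rewrite expRD; apply: ler_pM => //; try exact: expR_ge0.
exact: stair_ge.
Qed.

End weight_function.

(** * Small weights yield a covering point *)

Section deterministic.
Context {R : realType}.

(** In logarithms, a sample outside the cap contributes 0 and one inside at least (y - 26) / 5,
    where y is its normalized squared component. A negative sum means that y is below 26 on average
    over the samples in the cap. *)
Lemma prod_weight_lt1 d (t : R) (x v : 'rV[R]_d.+1) (zs : seq 'rV[R]_d.+1) :
  (0 < d)%N -> 0 < t < 1 -> dotp x x = 1 -> dotp v v <= 1 ->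
  \prod_(z <- zs) weight t (x, v) z < 1 ->
  d%:R / (1 - t ^+ 2) * \sum_(z <- zs | z \in capcone x t) dotp (perp x v) z ^+ 2
  < 26 * (\sum_(z <- zs | z \in capcone x t) 1).
Proof.
move=> d0 t01 x1 v1 w1.
pose h z : R := d%:R * dotp (perp x v) z ^+ 2 / (1 - t ^+ 2) / 5 - 26 / 5.
have hp : expR (\sum_(z <- zs | z \in capcone x t) h z) <=
    \prod_(z <- zs) weight t (x, v) z.
  elim: zs {w1} => [|z zs IHzs]; first by rewrite !big_nil expR0.
  rewrite !big_cons; case: ifPn => [|]; rewrite ?inE ?notin_setE => zA.
    rewrite expRD; apply: ler_pM; rewrite ?expR_ge0//.
    exact: weight_in.
  by rewrite weight_out// mul1r.
have : \sum_(z <- zs | z \in capcone x t) h z < 0.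
  by rewrite -ltr_expR expR0; exact: le_lt_trans hp w1.
rewrite big_split/= -mulr_suml -mulr_suml -mulr_sumr sumrN.
have -> : \sum_(z <- zs | z \in capcone x t) (26 / 5) =
    26 / 5 * (\sum_(z <- zs | z \in capcone x t) 1) :> R.
  by rewrite mulr_sumr; apply: eq_bigr => z _; rewrite mulr1.
by rewrite (mulrAC d%:R _^-1); lra.
Qed.

Section quadratic_form.
Variables (n : nat) (x : 'rV[R]_n) (zs : seq 'rV[R]_n) (P : pred 'rV[R]_n).

Definition qform (u : 'rV[R]_n) : R :=
  \sum_(z <- zs | P z) dotp (perp x u) z ^+ 2.

Lemma qform_ge0 u : 0 <= qform u.
Proof. by apply: sumr_ge0 => z _; exact: sqr_ge0. Qed.

Lemma perpD u w : perp x (u + w) = perp x u + perp x w.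
Proof. by rewrite /perp dotpDl scalerDl opprD addrACA. Qed.

Lemma perpZ c u : perp x (c *: u) = c *: perp x u.
Proof. by rewrite /perp dotpZl scalerBr scalerA. Qed.

Lemma qformD u w : qform (u + w) <= 2 * qform u + 2 * qform w.
Proof.
rewrite /qform !mulr_sumr -big_split/=; apply: ler_sum => z _.
rewrite perpD dotpDl; move: (dotp _ _) (dotp _ _) => a b.
by have := sqr_ge0 (a - b); lra.
Qed.

Lemma qformZ c u : qform (c *: u) = c ^+ 2 * qform u.
Proof.
rewrite /qform mulr_sumr; apply: eq_bigr => z _.
by rewrite perpZ dotpZl exprMn.
Qed.

Lemma qform_homog M u : (forall w, dotp w w = 1 -> qform w <= M) ->
  qform u <= dotp u u * M.
Proof.
move=> hM; have [/eqP|u0] := eqVneq (dotp u u) 0.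
  rewrite dotp_eq0 => /eqP ->; rewrite dotp0l mul0r.
  by rewrite -(scale0r 0) qformZ expr0n mul0r.
have up : 0 < dotp u u by rewrite lt_neqAle eq_sym u0 dotp_ge0.
pose c := Num.sqrt (dotp u u); have c0 : 0 < c by rewrite sqrtr_gt0.
have cE : c ^+ 2 = dotp u u by rewrite sqr_sqrtr// ltW.
have uE : u = c *: (c^-1 *: u) by rewrite scalerA mulfV ?scale1r// gt_eqF.
have u1 : dotp (c^-1 *: u) (c^-1 *: u) = 1.
  by rewrite !dotpE -cE; field; rewrite gt_eqF.
rewrite [in leLHS]uE qformZ -cE ler_wpM2l ?sqr_ge0//.
exact: hM.
Qed.

(* A bound on a 1/2-net of the sphere propagates to the whole sphere: if M is
   the supremum then M <= 2 a + 2 (M / 4). *)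
Lemma qform_net (V : seq 'rV[R]_n) (a : R) : dotp x x = 1 ->
  (forall z, P z -> dotp z z <= 1) ->
  (forall u, dotp u u = 1 -> exists2 v, v \in V & dotp (u - v) (u - v) <= 2^-1 ^+ 2) ->
  (forall v, v \in V -> qform v <= a) ->
  forall u, dotp u u = 1 -> qform u <= 4 * a.
Proof.
move=> x1 Pz netV aV; pose E := [set qform u | u in [set u | dotp u u = 1]].
have E0 : E !=set0 by exists (qform x), x.
have Eb : has_ubound E.
  exists (\sum_(z <- zs | P z) 1) => _ [u /= u1 <-].
  apply: ler_sum => z zP; apply: le_trans (dotp_CS _ _) _.
  have h1 : dotp (perp x u) (perp x u) <= 1.
    by rewrite perp_norm// u1; have := sqr_ge0 (dotp u x); lra.
  have h2 := Pz z zP; have := dotp_ge0 z; have := dotp_ge0 (perp x u).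
  by move: (dotp (perp x u) _) (dotp z z) h1 h2 => p q; nra.
have hM w : dotp w w = 1 -> qform w <= sup E.
  by move=> w1; apply: ub_le_sup => //; exists w.
have supE : sup E <= 2 * a + 2 * (2^-1 ^+ 2 * sup E).
  apply: ge_sup => // _ [u /= u1 <-]; have [v vV uv] := netV u u1.
  have -> : u = v + (u - v) by rewrite addrC subrK.
  apply: le_trans (qformD _ _) _; apply: lerD; first by rewrite ler_pM2l// aV.
  rewrite ler_pM2l//; apply: le_trans (qform_homog _ hM) _.
  by rewrite ler_wpM2r// (le_trans (qform_ge0 x))// hM.
move=> u /hM; have : (2^-1 : R) ^+ 2 = 4^-1 by field.
lra.
Qed.

End quadratic_form.

Lemma perp_perp n (x u : 'rV[R]_n) : dotp x x = 1 -> perp x (perp x u) = perp x u.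
Proof. by move=> x1; rewrite {1}/perp perp_orth// scale0r subr0. Qed.

(** (t' - t) (t' + t) = S^2 / (16 D) and t' + t <= 2 t'; hence the 32. *)
Lemma cap_gap (D t t' S r : R) : 1 <= D -> 0 < t < 1 -> 0 < t' ->
  t' ^+ 2 = t ^+ 2 + (1 - t ^+ 2) / (16 * D) -> S ^+ 2 = 1 - t ^+ 2 -> 0 < r ->
  r ^+ 2 = D -> S ^+ 2 / (r ^+ 2 * t') / 32 <= t' - t.
Proof.
move=> D1 t01 t'0 t'E SE r0 rE.
have /andP[tt' t'1] := shrunk_height D1 t01 (ltW t'0) t'E.
set k := _ / (_ * _).
have e : (t' - t) * (t' + t) = k * t' / 16.
  transitivity (t' ^+ 2 - t ^+ 2); first by ring.
  rewrite t'E /k SE -rE; field; by rewrite !gt_eqF.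
have h : k * t' / 16 <= (t' - t) * (2 * t').
  by rewrite -e ler_wpM2l//; move: tt'; clear; lra.
rewrite -(ler_pM2r t'0); move: h; clear; lra.
Qed.

(** Here k = S^2 / (r^2 t'), p = |z|, q = th^2, al = <y, x>, xz = <x, z> and wz = <w, z> for the
    component w of y orthogonal to x. The gap gains k p / 32; the loss is b^2 k p / 2 from al < 1
    and 11 b k <= 22 b k p from wz, and b <= 1/1000 makes it smaller. *)
Lemma cap_margin (t t' p k b q al xz wz : R) : 0 < t' -> t' <= 1 -> 0 < b ->
  b <= 1000^-1 -> 0 < k -> k / 32 <= t' - t -> t < t' -> 0 < t -> q * t' = b * (b * k) ->
  1 - q / 2 <= al -> 2^-1 <= p -> t' * p <= xz -> - (11 * (b * k)) <= wz ->
  t * p <= al * xz + wz.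
Proof.
move=> t'0 t'1 b0 b1 k0 gap tt' t0 qE al1 ph xzp wzg.
have bk0 : 0 < b * k by rewrite mulr_gt0.
have bk : b * k <= 1000^-1 * k by rewrite ler_pM2r.
have bbk : b * (b * k) <= b * k by apply: ler_piMl; [exact: ltW|move: b1; clear; lra].
have p0 : 0 <= p by move: ph; clear; lra.
have tp0 : 0 <= t' * p by rewrite mulr_ge0// ltW.
have al0 : 0 <= 1 - q / 2.
  have h : t' * q <= t' * 1.
    by rewrite mulrC qE mulr1; move: bbk bk gap t0; clear -k0; lra.
  by move: h; rewrite ler_pM2l//; clear; lra.
have h1 : (1 - q / 2) * (t' * p) <= al * xz by exact: ler_pM.
have h2 : (1 - q / 2) * (t' * p) = t' * p - b * (b * k) * p / 2 by rewrite -qE; ring.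
have h3 : (k / 32) * p <= (t' - t) * p by rewrite ler_wpM2r.
have h4 : k * 2^-1 <= k * p by rewrite ler_pM2l.
have h5 : b * (b * k) * p <= 1000^-1 * k * p.
  by rewrite ler_wpM2r//; exact: le_trans bbk bk.
rewrite h2 in h1; move: k0 h1 h3 h4 h5 bk wzg.
move: (b * (b * k) * p) (b * k) => B1 B2.
rewrite (_ : 1000^-1 * k * p = k * p / 1000); last by ring.
rewrite (_ : k / 32 * p = k * p / 32) ?mulrBl; last by ring.
move: (k * p) (t' * p) (t * p) => K1 T1 T2; clear; lra.
Qed.

(** Write y = <y, x> x + w, where |w| <= |y - x| <= th. The quadratic form bounds the average of <w,
    z>^2 over the samples in the cap of x, and a sample that is at most average covers y. *)
Lemma good_point d (t t' S r th b : R) (x : 'rV[R]_d.+1) (V zs : seq 'rV[R]_d.+1) :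
  (0 < d)%N -> 0 < t < 1 -> 0 < t' ->
  t' ^+ 2 = t ^+ 2 + (1 - t ^+ 2) / (16 * d%:R) ->
  0 < S -> S ^+ 2 = 1 - t ^+ 2 -> 0 < r -> r ^+ 2 = d%:R ->
  0 < b -> b <= 1000^-1 -> th = b * S / (r * t') -> dotp x x = 1 ->
  (forall v, v \in V -> dotp v v = 1) ->
  (forall u, dotp u u = 1 -> exists2 v, v \in V & dotp (u - v) (u - v) <= 2^-1 ^+ 2) ->
  (forall v, v \in V -> \prod_(z <- zs) weight t' (x, v) z < 1) ->
  forall y, dotp y y = 1 -> dotp (y - x) (y - x) <= th ^+ 2 ->
  exists2 z, z \in zs & 0 < dotp z z /\ t * Num.sqrt (dotp z z) <= dotp y z.
Proof.
move=> d0 /andP[t0 t1] t'0 t'E S0 SE r0 rE b0 b1 thE x1 V1 netV wV y y1 yx.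
have dR : 1 <= d%:R :> R by rewrite ler1n.
have S2 : 0 < 1 - t ^+ 2 by rewrite -SE exprn_gt0.
have t01 : 0 < t < 1 by rewrite t0.
have /andP[tt' t'1] := shrunk_height dR t01 (ltW t'0) t'E.
pose u := (16 * d%:R)^-1 : R.
have u0 : 0 < u by rewrite invr_gt0; lra.
have du : d%:R * u = 16^-1 by rewrite /u; field; rewrite gt_eqF//; lra.
have u1 : u <= 16^-1 by nra.
have t'E2 : t' ^+ 2 = t ^+ 2 + (1 - t ^+ 2) * u by [].
have S'2 : 0 < 1 - t' ^+ 2 by rewrite t'E2; nra.
have t'01 : 0 < t' < 1 by rewrite t'0.
have S'S : 1 - t' ^+ 2 <= S ^+ 2 by rewrite SE t'E2; nra.
pose P := [pred z | z \in capcone x t'].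
pose m : R := \sum_(z <- zs | P z) 1.
pose a := 26 * m * (1 - t' ^+ 2) / d%:R.
have kpos : 0 < d%:R / (1 - t' ^+ 2) by rewrite divr_gt0//; lra.
have qV v : v \in V -> qform x zs P v < a.
  move=> vV; have v1 : dotp v v <= 1 by rewrite V1.
  have := prod_weight_lt1 d0 t'01 x1 v1 (wV v vV).
  rewrite -/(qform x zs P v) -/m mulrC -ltr_pdivlMr//.
  by rewrite invf_div mulrA.
(* The cap contains a sample at all because the products are strictly below 1: without one they
   would equal 1. *)
have m0 : 0 < m.
  have [v vV _] := netV x x1.
  have := le_lt_trans (qform_ge0 x zs P v) (qV v vV).
  rewrite /a pmulr_lgt0 ?invr_gt0; last lra.
  by rewrite pmulr_lgt0// pmulr_rgt0.
have Pz z : P z -> dotp z z <= 1 by rewrite inE => -[].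
have q4 := qform_net x1 Pz netV (fun v vV => ltW (qV v vV)).
pose w := perp x y.
have wq : \sum_(z <- zs | P z) dotp w z ^+ 2 <= th ^+ 2 * (4 * a).
  have -> : \sum_(z <- zs | P z) dotp w z ^+ 2 = qform x zs P w.
    by apply: eq_bigr => z _; rewrite /w perp_perp.
  apply: le_trans (qform_homog w q4) _; rewrite ler_wpM2r//.
    have [v vV _] := netV x x1.
    have := le_lt_trans (qform_ge0 x zs P v) (qV v vV); lra.
  apply: le_trans yx; rewrite perp_norm// !dotpE x1 y1 (dotpC x y).
  by have := sqr_ge0 (1 - dotp y x); lra.
have [z zs_z [zP zw]] : exists2 z, z \in zs &
    P z /\ dotp w z ^+ 2 <= th ^+ 2 * (4 * a) / m.
  apply: contrapT => nz.
  have lt_z z : z \in zs -> P z -> th ^+ 2 * (4 * a) / m < dotp w z ^+ 2.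
    move=> zsz Pzz; rewrite ltNge; apply/negP => h; apply: nz.
    by exists z.
  have : th ^+ 2 * (4 * a) / m * m < \sum_(z <- zs | P z) dotp w z ^+ 2.
    rewrite {2}/m mulr_sumr big_seq_cond [ltRHS]big_seq_cond.
    apply: ltr_sum => [|z /andP[zsz Pzz]]; last by rewrite mulr1; exact: lt_z.
    apply/hasP; move: m0; rewrite /m => m0.
    apply: contrapT => nh; move: m0; rewrite big_seq_cond big1 ?ltxx// => z.
    by move=> h; exfalso; apply: nh; exists z => //; case/andP: h.
  by rewrite divfK ?gt_eqF//; lra.
have := zP; rewrite inE => -[z1 z2 z3 z4].
exists z => //; split; first lra.
pose p := Num.sqrt (dotp z z); have p0 : 0 <= p by exact: sqrtr_ge0.
have pE : p ^+ 2 = dotp z z by rewrite sqr_sqrtr// dotp_ge0.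
have ph : 2^-1 <= p by apply: ler_sqr_nneg => //; rewrite pE (_ : 2^-1 ^+ 2 = 4^-1)//; field.
have xz : t' * p <= dotp x z by apply: ler_sqr_nneg => //; rewrite exprMn pE.
have yE : dotp y z = dotp y x * dotp x z + dotp w z.
  by rewrite /w /perp !dotpE; ring.
have al : 1 - th ^+ 2 / 2 <= dotp y x.
  by move: yx; rewrite !dotpE x1 y1 (dotpC x y); lra.
have dr : d%:R = r ^+ 2 by [].
have aE : th ^+ 2 * (4 * a) / m = 104 * th ^+ 2 * (1 - t' ^+ 2) / r ^+ 2.
  by rewrite /a dr; field; rewrite !gt_eqF.
(* The 104 = 4 * 26 combines the loss of [qform_net] with the bound 26 of [prod_weight_lt1], and 104
   <= 11^2. *)
pose g := 11 * th * S / r.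
have th0 : 0 < th by rewrite thE divr_gt0 ?mulr_gt0.
have g0 : 0 <= g by rewrite /g divr_ge0 ?mulr_ge0// ltW.
have wz : - g <= dotp w z.
  have : (- dotp w z) <= g; last by lra.
  apply: ler_sqr_nneg => //; rewrite sqrrN; apply: le_trans zw _; rewrite aE /g.
  rewrite expr_div_n ler_pM2r ?invr_gt0 ?exprn_gt0// !exprMn.
  have : 0 <= th ^+ 2 * (S ^+ 2 - (1 - t' ^+ 2)) by rewrite mulr_ge0 ?sqr_ge0//; lra.
  have : 0 <= th ^+ 2 * S ^+ 2 by rewrite mulr_ge0 ?sqr_ge0.
  lra.
pose k := S ^+ 2 / (r ^+ 2 * t').
have k0 : 0 < k by rewrite divr_gt0 ?mulr_gt0 ?exprn_gt0.
have gk : g = 11 * (b * k) by rewrite /g /k thE; field; rewrite !gt_eqF.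
have thk : th ^+ 2 * t' = b * (b * k) by rewrite /k thE; field; rewrite !gt_eqF.
have gap : k / 32 <= t' - t by exact: cap_gap dR t01 t'0 t'E SE r0 rE.
rewrite -/p yE; rewrite gk in wz.
exact: cap_margin t'0 (ltW t'1) b0 b1 k0 gap tt' t0 thk al ph xz wz.
Qed.

End deterministic.

(** * Random points together with bad centers form a net *)

Section existence.
Context {R : realType}.

(** Even for t close to 0 the term S^2 / 16 keeps r t' >= 1/4, so that th <= 4 b S. The last bound
    says that a center covers every point within th of it, which is why adding the bad centers
    completes the net. *)
Lemma radius_bounds (D t t' S r th b : R) : 1 <= D -> 0 < t < 1 -> 0 < t' ->
  t' ^+ 2 = t ^+ 2 + (1 - t ^+ 2) / (16 * D) -> 0 < S -> S ^+ 2 = 1 - t ^+ 2 ->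
  0 < r -> r ^+ 2 = D -> 0 < b -> b <= 8^-1 -> th = b * S / (r * t') ->
  [/\ 0 < th, th < 1 & t <= 1 - th ^+ 2 / 2].
Proof.
move=> D1 /andP[t0 t1] t'0 t'E S0 SE r0 rE b0 b1 thE.
have th0 : 0 < th by rewrite thE divr_gt0 ?mulr_gt0.
have rt : r ^+ 2 * t' ^+ 2 = D * t ^+ 2 + S ^+ 2 / 16.
  by rewrite t'E rE -SE; field; rewrite gt_eqF//; lra.
have rt1 : 16^-1 <= r ^+ 2 * t' ^+ 2.
  have : t ^+ 2 <= D * t ^+ 2 by rewrite ler_peMl// sqr_ge0.
  by rewrite rt; have := sqr_ge0 t; lra.
have hE : th ^+ 2 * (r ^+ 2 * t' ^+ 2) = b ^+ 2 * S ^+ 2.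
  by rewrite thE; field; rewrite !gt_eqF.
have b2 : b ^+ 2 <= 64^-1 by rewrite (_ : 64^-1 = 8^-1 ^+ 2); [nra|field].
have S2 : 0 <= S ^+ 2 by exact: sqr_ge0.
have th2 : th ^+ 2 * 16^-1 <= 64^-1 * S ^+ 2.
  apply: le_trans (_ : b ^+ 2 * S ^+ 2 <= _); last by rewrite ler_wpM2r.
  by rewrite -hE ler_wpM2l// sqr_ge0.
have S1 : S ^+ 2 <= 1 by rewrite SE; have := sqr_ge0 t; lra.
split => //; last by rewrite SE in th2; nra.
by nra.
Qed.

(** Samples come from the ball; the value at 0 only serves to keep all images on the sphere. *)
Definition normalize d (z : 'rV[R]_d.+1) : 'rV[R]_d.+1 :=
  if dotp z z == 0 then pole d else (Num.sqrt (dotp z z))^-1 *: z.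

Lemma normalize_sphere d (z : 'rV[R]_d.+1) :
  dotp (normalize z) (normalize z) = 1.
Proof.
rewrite /normalize; case: ifPn => [_|z0]; first by rewrite dotp_pole mxE.
have zp : 0 < dotp z z by rewrite lt_neqAle eq_sym z0 dotp_ge0.
rewrite dotpZl dotpZr mulrA -expr2 exprVn sqr_sqrtr ?ltW//.
by rewrite mulVf.
Qed.

(** A bad center has a direction whose product of weights is at least 1, so the sum of all products
    after N choices bounds the number of bad centers. *)
Lemma net_count d (eps t t' S r th b : R) (N : nat) :
  (0 < d)%N -> 0 < eps < pi / 2 -> t = cos eps -> 0 < t < 1 -> 0 < t' ->
  t' ^+ 2 = t ^+ 2 + (1 - t ^+ 2) / (16 * d%:R) ->
  0 < S -> S ^+ 2 = 1 - t ^+ 2 -> 0 < r -> r ^+ 2 = d%:R ->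
  0 < b -> b <= 1000^-1 -> th = b * S / (r * t') ->
  exists Y : seq 'rV[R]_d.+1,
    [/\ (size Y)%:R <= N%:R + expR (- (capV d eps / 100 * N%:R)) *
          ((3 * d.+1%:R * (1 + 2 / th) ^+ d) *
           (3 * d.+1%:R * (1 + 2 / 2^-1) ^+ d)),
        forall y, y \in Y -> sphere y &
        forall y, sphere y -> exists2 q, q \in Y & geodist y q <= eps].
Proof.
move=> d0 he tE t01 t'0 t'E S0 SE r0 rE b0 b1 thE; have /andP[t0 t1] := t01.
have dR : 1 <= d%:R :> R by rewrite ler1n.
have b8 : b <= 8^-1 by lra.
have [th0 th1 tth] := radius_bounds dR t01 t'0 t'E S0 SE r0 rE b0 b8 thE.
have th01 : 0 < th < 1 by rewrite th0.
have h01 : 0 < (2^-1 : R) < 1 by apply/andP; split; lra.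
have [X [Xs X1 Xn]] := @sphere_net R d _ th01.
have [VV [Vs V1 Vn]] := @sphere_net R d _ h01.
have /andP[_ t'1] := shrunk_height dR t01 (ltW t'0) t'E.
have t'01 : 0 < t' < 1 by rewrite t'0.
pose B := euball d.+1 1 : set 'rV[R]_d.+1.
have fB : fvol B by exact: fvol_euball.
have B0 : 0 < vol B by exact: vol_euball1_gt0.
pose A := vol (shell_cone d t'); pose p := A / vol B.
have AE : A = p * vol B by rewrite /p divfK ?gt_eqF.
(* The loss is 35 from shrinking and 4/3 from discarding short vectors, and 35 * 4/3 <= 50. *)
have pV : capV d eps / 50 <= p.
  rewrite capVE// -tE /p mulrAC ler_pM2r ?invr_gt0//.
  have := vol_scone_shrink d0 t01 (ltW t'0) t'E.
  have := vol_shell_cone t' d0; rewrite -/A.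
  have := vol_ge0 (scone d t); lra.
have p0 : 0 < p.
  apply: lt_le_trans pV; rewrite divr_gt0// capVE// -tE divr_gt0//.
  exact: vol_scone_gt0.
have p1 : p <= 1.
  rewrite /p ler_pdivrMr// mul1r; apply: le_vol => //; first exact: mset_shell_cone.
  by move=> z [[]].
pose s := [seq (x, v) | x <- X, v <- VV].
have hint i : i \in s ->
    (integ B (weight t' i) <= ((1 - 23 / 32 * p) * vol B)%:E)%E.
  move=> /allpairsP[[x v] /= [xX vV ->]].
  have v1 : dotp v v <= 1 by rewrite V1.
  apply: le_trans (integ_weight d0 t'01 (X1 x xX) v1) _.
  by rewrite lee_fin -/A AE -/B; lra.
(* Replacing 23/32 by 1/2 leaves the strict gap that [averaging] requires; the factor per sample is
   then at most exp (- p / 2) <= exp (- [capV d eps] / 100). *)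
have a01 : 0 <= 1 - 23 / 32 * p < 1 - p / 2 by apply/andP; split; lra.
have [zs [zN zB zle]] := greedy_choice N fB B0 (@mfunc_weight R d t')
  (@weight_ge0 R d t') a01 hint.
pose bad x := has (fun v => 1 <= \prod_(z <- zs) weight t' (x, v) z) VV.
exists (map (@normalize d) zs ++ [seq x <- X | bad x]); split.
- rewrite size_cat size_map zN natrD lerD2l.
  apply: le_trans (_ : \sum_(i <- s) \prod_(z <- zs) weight t' i z <= _).
    rewrite /s big_allpairs size_filter -sum1_count natr_sum [leLHS]big_mkcond /=.
    apply: ler_sum => x _; have w0 v : 0 <= \prod_(z <- zs) weight t' (x, v) z.
      by apply: prodr_ge0 => z _; exact: weight_ge0.
    case: ifPn => [/hasP[v vV hv]|_]; last by apply: sumr_ge0.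
    rewrite (big_rem v)//=; apply: le_trans hv _; rewrite lerDl.
    by apply: sumr_ge0.
  apply: le_trans zle _; apply: ler_pM => //.
  + by apply: exprn_ge0; lra.
  + have -> : - (capV d eps / 100 * N%:R) = N%:R * - (capV d eps / 100) by ring.
    rewrite expRM_natl; apply: lerXn2r; rewrite ?nnegrE ?expR_ge0//; first lra.
    apply: le_trans (_ : expR (- (p / 2)) <= _).
      by have := expR_ge1Dx (- (p / 2)); lra.
    by rewrite ler_expR; lra.
  + rewrite size_allpairs natrM; apply: ler_pM => //.
- move=> y; rewrite mem_cat => /orP[/mapP[z _ ->]|].
    exact: normalize_sphere.
  by rewrite mem_filter => /andP[_ /X1].
- have pi0 := pi_gt0 R; have /andP[e0 e1] := he.
  have epi : 0 <= eps <= pi by apply/andP; split; lra.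
  move=> y y1; have [x xX xy] := Xn y y1.
  have [bx|gx] := boolP (bad x).
    exists x; first by rewrite mem_cat mem_filter bx xX orbT.
    have x1 := X1 x xX.
    rewrite /geodist acos_le//; last exact: dotp_sphere_bound.
    have y1' : dotp y y = 1 by [].
    by move: xy; rewrite -tE !dotpE x1 y1' (dotpC x y); lra.
  have wV v : v \in VV -> \prod_(z <- zs) weight t' (x, v) z < 1.
    by move=> vV; rewrite ltNge; apply/negP => h; move/hasPn: gx => /(_ v vV); rewrite h.
  have [z zzs [z0 hz]] := good_point d0 t01 t'0 t'E S0 SE r0 rE b0 b1 thE
    (X1 x xX) V1 Vn wV y1 xy.
  exists (normalize z); first by rewrite mem_cat map_f.
  rewrite /geodist acos_le//; last by apply: dotp_sphere_bound => //; exact: normalize_sphere.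
  rewrite -tE /normalize gt_eqF// dotpZr mulrC ler_pdivlMr// sqrtr_gt0//.
Qed.

End existence.

(** * Cardinality *)

Section entropy.
Context {R : realType}.

Lemma expR_half_lt2 : expR 2^-1 < 2 :> R.
Proof.
have h : (3 / 4) ^+ 2 <= expR (- 2^-1) :> R.
  have -> : - 2^-1 = 2%:R * - 4^-1 :> R by field.
  rewrite expRM_natl; apply: lerXn2r; rewrite ?nnegrE ?expR_ge0//.
  by have := expR_ge1Dx (- 4^-1 : R); lra.
have e0 := expR_gt0 (2^-1 : R).
have : expR (- 2^-1) * expR 2^-1 = 1 :> R by rewrite -expRD addNr expR0.
nra.
Qed.

Lemma ln2_gt : 2^-1 < ln 2 :> R.
Proof. by rewrite -ltr_expR lnK ?posrE// expR_half_lt2. Qed.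

Lemma ln4_gt1 : 1 < ln 4 :> R.
Proof.
have -> : 4 = 2 * 2 :> R by ring.
by rewrite lnM ?posrE//; have := ln2_gt; lra.
Qed.

Lemma ln_inv_ge (V c : R) : 0 < V -> V ^+ 2 <= expR (- c) ->
  2^-1 + c / 2 <= ln (2 / V).
Proof.
move=> V0 Vc; rewrite ln_div ?posrE//.
have : ln (V ^+ 2) <= - c by rewrite -ler_expR lnK ?posrE ?exprn_gt0.
by rewrite expr2 lnM ?posrE//; have := ln2_gt; lra.
Qed.

(** The number M of pairs is at most (K r t' / S)^d, with r^2 t'^2 = d t^2 + S^2 / 16. If t^2 <=
    1/2, then S is bounded below, and V <= S^(d+1) gives d t^2 <= 2 ln (2 / V). If t^2 > 1/2, then V
    <= (4 S)^d cancels S^-d, and the bound V <= 2^(-(d+1)/2), obtained at height sqrt (1/2), gives d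
    <= 4 ln (2 / V). *)
Lemma net_entropy d (t t' S r th b V : R) :
  (0 < d)%N -> 0 < t < 1 -> 0 < t' ->
  t' ^+ 2 = t ^+ 2 + (1 - t ^+ 2) / (16 * d%:R) ->
  0 < S -> S ^+ 2 = 1 - t ^+ 2 -> 0 < r -> r ^+ 2 = d%:R ->
  0 < b -> b <= 1000^-1 -> th = b * S / (r * t') ->
  V = vol (scone d t) / vol (euball d.+1 1) ->
  (3 * d.+1%:R * (1 + 2 / th) ^+ d * (3 * d.+1%:R * (1 + 2 / 2^-1) ^+ d) * V) ^+ 2
  <= (64 * (540 / b) ^+ 2 * ln (2 / V)) ^+ d.
Proof.
move=> d0 t01 t'0 t'E S0 SE r0 rE b0 b1 thE VE; have /andP[t0 t1] := t01.
have dR : 1 <= d%:R :> R by rewrite ler1n.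
have b8 : b <= 8^-1 by lra.
have [th0 th1 _] := radius_bounds dR t01 t'0 t'E S0 SE r0 rE b0 b8 thE.
have be0 := @vol_euball1_gt0 R d.+1.
have V0 : 0 < V by rewrite VE; exact: divr_gt0 (vol_scone_gt0 d t01) be0.
(* 540 = 3 * 3 * 2 * 2 * 5 * 3: twice 3 (d + 1) <= 3^d 2^d, then 5 = 1 + 2 / 2^-1 from the net of
   directions, and 1 + 2 / th <= 3 / th. *)
pose K := 540 / b.
have K0 : 0 < K by apply: divr_gt0 b0; rewrite ltr0n.
set M := (3 * _ * _ * (3 * _ * _)); have M0 : 0 <= M.
  have : 0 < 2 / th by rewrite divr_gt0.
  by move=> h; rewrite /M !mulr_ge0 ?exprn_ge0//; lra.
have MK : M <= (K * (r * t') / S) ^+ d.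
  have n2 : d.+1%:R <= 2 ^+ d :> R by rewrite -natrX ler_nat ltn_expl.
  have n0 : 0 <= d.+1%:R :> R by [].
  have h1 : (1 + 2 / th) ^+ d <= (3 / th) ^+ d.
    have ti : 1 <= th^-1 by rewrite invf_ge1// ltW.
    by apply: lerXn2r; rewrite ?nnegrE; lra.
  have -> : K * (r * t') / S = 3 * 3 * 2 * 2 * 5 * (3 / th).
    by rewrite /K thE; field; rewrite !gt_eqF.
  have -> : M = (3 * d.+1%:R) * (3 * d.+1%:R) * 5 ^+ d * (1 + 2 / th) ^+ d.
    have -> : 5 = 1 + 2 / 2^-1 :> R by field.
    by rewrite /M; ring.
  have p1 : 0 <= 3 * d.+1%:R * (3 * d.+1%:R) * 5 ^+ d :> R.
    by rewrite !mulr_ge0 ?exprn_ge0.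
  have p2 : 0 <= (1 + 2 / th) ^+ d.
    by have h : 0 < 2 / th; [rewrite divr_gt0|rewrite exprn_ge0//; lra].
  rewrite (exprMn d _ (3 / th)); apply: (ler_pM p1 p2 _ h1).
  rewrite [leRHS](_ : _ = (3 ^+ d * 2 ^+ d) * (3 ^+ d * 2 ^+ d) * 5 ^+ d); last first.
    by rewrite !exprMn; ring.
  rewrite ler_pM2r ?exprn_gt0//.
  have h3 : 3 <= 3 ^+ d :> R by rewrite -{1}[3]expr1 ler_weXn2l// ler1n.
  have h6 : 3 * d.+1%:R <= 3 ^+ d * 2 ^+ d :> R by apply: ler_pM.
  by apply: ler_pM => //; rewrite mulr_ge0.
have t'1 : t' ^+ 2 <= 1.
  have : (16 * d%:R)^-1 <= 1 :> R by rewrite invf_le1//; lra.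
  have S2 : 0 < 1 - t ^+ 2 by rewrite -SE exprn_gt0.
  by rewrite t'E => /(ler_wpM2l (ltW S2)); lra.
have rt : r ^+ 2 * t' ^+ 2 = d%:R * t ^+ 2 + S ^+ 2 / 16.
  by rewrite t'E rE -SE; field; rewrite gt_eqF//; lra.
rewrite -/K; clearbody K M.
have pKr : 0 <= K * (r * t').
  exact: mulr_ge0 (ltW K0) (mulr_ge0 (ltW r0) (ltW t'0)).
have pK : 0 <= K * (r * t') / S by rewrite divr_ge0// ltW.
have pMV : 0 <= M * V by rewrite mulr_ge0// ltW.
have K20 : 0 < K ^+ 2 by rewrite exprn_gt0.
have Vh : V <= 2^-1.
  by rewrite VE ler_pdivrMr// mulrC; exact: vol_scone_half.
have [t2|t2] := leP (t ^+ 2) 2^-1.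
  have Vq : V <= S ^+ d.+1.
    by rewrite VE ler_pdivrMr//; exact: vol_scone_le_ball.
  have Ve : V ^+ 2 <= expR (- (d.+1%:R * t ^+ 2)).
    apply: le_trans (_ : (S ^+ d.+1) ^+ 2 <= _).
      by apply: lerXn2r; rewrite ?nnegrE ?exprn_ge0 ?(ltW S0) ?(ltW V0).
    have -> : - (d.+1%:R * t ^+ 2) = d.+1%:R * - t ^+ 2 by ring.
    rewrite -exprM mulnC exprM SE expRM_natl.
    apply: lerXn2r; rewrite ?nnegrE ?expR_ge0//; first by lra.
    by have := expR_ge1Dx (- t ^+ 2); lra.
  have := ln_inv_ge V0 Ve; rewrite -[d.+1%:R]natr1 => Lg.
  apply: le_trans (_ : ((K * (r * t') / S) ^+ d) ^+ 2 <= _).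
    apply: lerXn2r; [by rewrite nnegrE|by rewrite nnegrE exprn_ge0|].
    apply: le_trans MK; rewrite -[leRHS]mulr1 ler_wpM2l//; lra.
  have Dt : 0 <= d%:R * t ^+ 2 by rewrite mulr_ge0 ?sqr_ge0.
  have tt := sqr_ge0 t.
  have Lp : 0 <= ln (2 / V) by lra.
  rewrite -exprM mulnC exprM; apply: lerXn2r.
  - by rewrite nnegrE sqr_ge0.
  - by rewrite nnegrE; exact: mulr_ge0 (mulr_ge0 (ler0n R 64) (ltW K20)) Lp.
  have -> : (K * (r * t') / S) ^+ 2 = K ^+ 2 * ((r ^+ 2 * t' ^+ 2) / S ^+ 2).
    by field; rewrite gt_eqF.
  rewrite [leRHS](_ : _ = K ^+ 2 * (64 * ln (2 / V))); last by ring.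
rewrite ler_pM2l// rt ler_pdivrMr ?exprn_gt0//.
  have S2 : 2^-1 <= S ^+ 2 by rewrite SE; lra.
  have : 64 * (2^-1 + (d%:R * t ^+ 2) / 2) * S ^+ 2 <= 64 * ln (2 / V) * S ^+ 2.
    by rewrite ler_wpM2r ?sqr_ge0//; lra.
  have : (d%:R * t ^+ 2) * 2^-1 <= (d%:R * t ^+ 2) * S ^+ 2 by rewrite ler_wpM2l.
  lra.
have Vq : V <= (4 * S) ^+ d.
  rewrite VE ler_pdivrMr//; apply: vol_scone_small => //; exact: ltW.
have Ve : V ^+ 2 <= expR (- (d.+1%:R * 2^-1)).
  pose q := Num.sqrt 2^-1 : R; have q0 : 0 < q by rewrite sqrtr_gt0.
  have qE : q ^+ 2 = 2^-1 by rewrite sqr_sqrtr.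
  have qt : q <= t by apply: ler_sqr_nneg; [exact: ltW|rewrite qE; exact: ltW].
  have Vq' : V <= q ^+ d.+1.
    rewrite VE ler_pdivrMr//; apply: le_trans (vol_scone_mono d (ltW q0) qt) _.
    by apply: vol_scone_le_ball => //; rewrite qE; lra.
  apply: le_trans (_ : (q ^+ d.+1) ^+ 2 <= _).
    by apply: lerXn2r; rewrite ?nnegrE ?exprn_ge0 ?(ltW q0) ?(ltW V0).
  have -> : - (d.+1%:R * 2^-1) = d.+1%:R * - 2^-1 :> R by ring.
  rewrite -exprM mulnC exprM qE expRM_natl.
  apply: lerXn2r; rewrite ?nnegrE ?expR_ge0//.
  by have := expR_ge1Dx (- 2^-1 : R); lra.
have := ln_inv_ge V0 Ve; rewrite -[d.+1%:R]natr1 => Lg.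
apply: le_trans (_ : ((4 * K * (r * t')) ^+ d) ^+ 2 <= _).
  apply: lerXn2r; [by rewrite nnegrE| |].
    by rewrite nnegrE exprn_ge0// -mulrA mulr_ge0.
  have -> : 4 * K * (r * t') = (K * (r * t') / S) * (4 * S).
    by field; rewrite gt_eqF.
  by rewrite exprMn; apply: ler_pM => //; exact: ltW.
have Lp : 0 <= ln (2 / V) by lra.
rewrite -exprM mulnC exprM; apply: lerXn2r.
- by rewrite nnegrE sqr_ge0.
- by rewrite nnegrE; exact: mulr_ge0 (mulr_ge0 (ler0n R 64) (ltW K20)) Lp.
have -> : (4 * K * (r * t')) ^+ 2 = K ^+ 2 * (16 * (r ^+ 2 * t' ^+ 2)) by ring.
rewrite [leRHS](_ : _ = K ^+ 2 * (64 * ln (2 / V))); last by ring.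
rewrite ler_pM2l// rE.
have : d%:R * t' ^+ 2 <= d%:R * 1 by rewrite ler_wpM2l.
lra.
Qed.

(** At most exp (- La) M <= 1 / V centers are bad, and rounding N up costs at most 1 <= 1 / V; this
    is the 2. *)
Lemma total_count (M V La N : R) : 0 < V -> V <= 2^-1 -> 0 <= M ->
  M * V <= expR La -> N <= 100 * La / V + 1 -> La <= V / 100 * N ->
  N + expR (- (V / 100 * N)) * M <= (100 * La + 2) / V.
Proof.
move=> V0 Vh M0 MV N2 VN.
have h1 : expR (- (V / 100 * N)) * M <= expR (- La) * M.
  by rewrite ler_wpM2r// ler_expR lerN2.
have h2 : expR (- La) * M <= V^-1.
  by rewrite expRN mulrC ler_pdivrMr ?expR_gt0// mulrC ler_pdivlMr.
have h3 : 1 <= V^-1 by rewrite invf_ge1//; lra.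
by rewrite mulrDl; move: h1 h2 h3 N2; clear; lra.
Qed.

(** Additive constants turn into multiples of l, which stays above the positive l0. *)
Lemma constant_bound (D k l l0 : R) : 1 <= D -> 0 <= k -> 0 < l0 -> l0 <= l ->
  100 * (D / 2 * (k + l)) + 2 <= D * ((50 * (k / l0 + 1) + 2 / l0) * l).
Proof.
move=> D1 k0 l00 ll; have n0 := lt0r_neq0 l00.
have h1 : k <= k / l0 * l.
  by rewrite -{1}(divfK n0 k) ler_wpM2l// divr_ge0// ltW.
have h2 : 2 <= 2 / l0 * l by rewrite -{1}(divfK n0 2) ler_pM2l// divr_gt0.
have h3 : 2 / l0 * l <= D * (2 / l0 * l) by rewrite ler_peMl//; lra.
have h4 : D * k <= D * (k / l0 * l) by rewrite ler_wpM2l//; lra.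
lra.
Qed.

End entropy.

Theorem corollary1p8 (R : realType) :
  exists C : R, 0 < C /\
    forall (d : nat) (eps : R), (2 <= d)%N -> 0 < eps < pi / 2 ->
      exists N : {fset 'rV[R]_d.+1},
        geodesic_net eps [set` N] /\
        (#|` N|)%:R <=
          d%:R * Num.max 2 (C * ln (ln (2 / capV d eps)) / capV d eps).
Proof.
have [b [b0 b1]] : exists b : R, 0 < b /\ b <= 1000^-1.
  by exists 1000^-1; split; [lra|exact: lexx].
(* Since V <= 1/2, this is a lower bound for ln ln (2 / V); it is positive because ln 4 > 1. *)
pose l0 : R := ln (ln 4).
have l00 : 0 < l0 by rewrite ln_gt0// ln4_gt1.
have K1 : 1 <= 64 * (540 / b) ^+ 2.
  have : 1 <= 540 / b by rewrite ler_pdivlMr// mul1r; lra.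
  by move: (540 / b) => K h; nra.
pose k : R := ln (64 * (540 / b) ^+ 2); have k0 : 0 <= k by rewrite ln_ge0.
pose C : R := 50 * (k / l0 + 1) + 2 / l0.
have kl0 : 0 <= k / l0 by rewrite divr_ge0// ltW.
have il0 : 0 < 2 / l0 by rewrite divr_gt0.
exists C; split; first by rewrite /C; lra.
move=> d eps d2 he; have d0 : (0 < d)%N by exact: ltnW.
have dR : 1 <= d%:R :> R by rewrite ler1n.
have /andP[e0 e1] := he; have pi0 := pi_gt0 R.
pose t := cos eps; have t0 : 0 < t.
  by apply: cos_gt0_pihalf; apply/andP; split; lra.
have t1 : t < 1.
  by rewrite -(cos0 R) ltr_cos// in_itv/=; apply/andP; split; lra.
have t01 : 0 < t < 1 by rewrite t0.
have S20 : 0 < 1 - t ^+ 2 by nra.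
pose S := Num.sqrt (1 - t ^+ 2); have S0 : 0 < S by rewrite sqrtr_gt0.
have SE : S ^+ 2 = 1 - t ^+ 2 by rewrite sqr_sqrtr// ltW.
pose r : R := Num.sqrt d%:R; have r0 : 0 < r by rewrite sqrtr_gt0; lra.
have rE : r ^+ 2 = d%:R by rewrite sqr_sqrtr//; lra.
pose t2 := t ^+ 2 + (1 - t ^+ 2) / (16 * d%:R).
have t20 : 0 < t2.
  by rewrite addr_gt0 ?exprn_gt0// divr_gt0// mulr_gt0//; lra.
pose t' := Num.sqrt t2; have t'0 : 0 < t' by rewrite sqrtr_gt0.
have t'E : t' ^+ 2 = t2 by rewrite sqr_sqrtr// ltW.
pose V := capV d eps.
have be0 := @vol_euball1_gt0 R d.+1.
have VE : V = vol (scone d t) / vol (euball d.+1 1) by exact: capVE.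
have V0 : 0 < V by rewrite VE; exact: divr_gt0 (vol_scone_gt0 d t01) be0.
have Vh : V <= 2^-1 by rewrite VE ler_pdivrMr// mulrC; exact: vol_scone_half.
pose L := ln (2 / V).
have L4 : ln 4 <= L.
  have h : 4 <= 2 / V by rewrite ler_pdivlMr//; lra.
  by rewrite /L ler_ln // posrE; [lra|exact: divr_gt0].
have l4 := @ln4_gt1 R.
have L0 : 0 < L by lra.
have lL : l0 <= ln L by rewrite ler_ln ?posrE//; lra.
pose th := b * S / (r * t').
have ent := net_entropy d0 t01 t'0 t'E S0 SE r0 rE b0 b1 (erefl th) VE.
rewrite -/L in ent.
set M := (3 * _ * _ * (3 * _ * _)) in ent.
(* The logarithm of the bound on M V that results from [net_entropy] by taking a square root. *)
pose La := d%:R / 2 * (k + ln L).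
have La0 : 0 <= La by rewrite mulr_ge0//; lra.
have G0 : 0 < 64 * (540 / b) ^+ 2 by lra.
have M0 : 0 <= M.
  have th0 : 0 < th by rewrite /th divr_gt0 ?mulr_gt0.
  have h1 : 0 <= (1 + 2 / th) ^+ d.
    by have h : 0 < 2 / th; [rewrite divr_gt0|rewrite exprn_ge0//; lra].
  have h2 : 0 <= (1 + 2 / 2^-1) ^+ d :> R by rewrite exprn_ge0//; lra.
  have h3 : 0 <= 3 * d.+1%:R :> R by rewrite mulr_ge0.
  exact: mulr_ge0 (mulr_ge0 h3 h1) (mulr_ge0 h3 h2).
have MV : M * V <= expR La.
  apply: ler_sqr_nneg; first exact: expR_ge0.
  apply: le_trans ent _; rewrite -expRM_natl (_ : 2%:R * La = d%:R * (k + ln L)).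
    rewrite expRM_natl expRD lnK ?posrE// lnK ?posrE//.
  by rewrite /La; field.
pose N := (Num.truncn (100 * La / V)).+1.
have N1 : 100 * La / V < N%:R by exact: truncnS_gt.
have N2 : N%:R <= 100 * La / V + 1.
  by rewrite /N -natr1 lerD2r truncn_le divr_ge0// ?(ltW V0)// mulr_ge0.
have [Y [Ysz Ysph Ycov]] :=
  net_count N d0 he (erefl t) t01 t'0 t'E S0 SE r0 rE b0 b1 (erefl th).
rewrite -/V -/M in Ysz.
have VN : La <= V / 100 * N%:R.
  move: N1; rewrite ltr_pdivrMr// => N1; lra.
have tot : (size Y)%:R <= (100 * La + 2) / V.
  exact: le_trans Ysz (total_count V0 Vh M0 MV N2 VN).
have C1 : 100 * La + 2 <= d%:R * (C * ln L) by exact: constant_bound.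
exists [fset y in Y]%fset; split.
  split; first by move=> y /=; rewrite inE; exact: Ysph.
  move=> y /Ycov [q qY yq]; exists q => //=.
  by rewrite inE.
rewrite card_fseq; apply: le_trans (_ : (size Y)%:R <= _).
  by rewrite ler_nat size_undup.
apply: le_trans tot _; apply: le_trans (_ : d%:R * (C * ln L / V) <= _).
  by rewrite mulrA ler_pM2r ?invr_gt0.
by rewrite ler_wpM2l ?ler0n// le_max lexx orbT.
Qed.
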